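(* Let $G$ be a compact Lie group with Lie algebra $\mathfrak g$ acting on a smooth manifold $M$, with infinitesimal action $\psi:\mathfrak g\to\mathfrak X(M)$, $\psi(\xi)=X_\xi$. Let $\mathfrak h$ be a $\mathfrak g$-module, let $\mu:\mathfrak h\to C^\infty(M)$ be a $\mathfrak g$-equivariant linear map, and let $h\in\Omega^2(M)$. Then the map $\rho:\mathfrak a_{\mathfrak g}^{\mathfrak h}\to\Gamma(TM\oplus T^*M)$ given by $$\rho(\xi,\eta)=(X_\xi,\alpha_{(\xi,\eta)}),\qquad \alpha_{(\xi,\eta)}=d\mu(\eta)+i_{X_\xi}h,$$ defines an extended action of the hemisemidirect product $\mathfrak a_{\mathfrak g}^{\mathfrak h}$ on the exact Courant algebroid $TM\oplus T^*M$ twisted by the exact $3$-form $H=dh$ if and only if $\mathcal L_{X_\xi}h=0$ for all $\xi\in\mathfrak g$.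
   Context: Twisted Courant algebroid. For a closed $3$-form $H$, the $H$-twisted Dorfman bracket on $\Gamma(TM\oplus T^*M)$ is $[X\oplus\alpha,Y\oplus\beta]_H=[X,Y]\oplus(\mathcal L_X\beta-i_Yd\alpha-i_Yi_XH)$. Leibniz and Courant algebras. A Leibniz algebra is a vector space with a bilinear bracket satisfying $[a,[b,c]]=[[a,b],c]+[b,[a,c]]$. A Courant algebra over a Lie algebra $\mathfrak g$ is a Leibniz algebra $\mathfrak a$ with a morphism of Leibniz algebras (bracket-preserving linear map) $\pi:\mathfrak a\to\mathfrak g$; it is exact if $\pi$ is surjective and $\ker\pi$ is abelian (its bracket vanishes). Hemisemidirect product. For a $\mathfrak g$-module $\mathfrak h$ with action $\xi\cdot\eta$, $\mathfrak a_{\mathfrak g}^{\mathfrak h}=\mathfrak g\oplus\mathfrak h$ with the Leibniz product $(\xi,\eta)\cdot(\xi',\eta')=([\xi,\xi'],\xi\cdot\eta')$; with $\pi(\xi,\eta)=\xi$ it is an exact Courant algebra over $\mathfrak g$ with $\ker\pi=0\oplus\mathfrak h\cong\mathfrak h$. Equivariance. $\mu:\mathfrak h\to C^\infty(M)$ is $\mathfrak g$-equivariant if $\mu(\xi\cdot\eta)=\mathcal L_{X_\xi}\mu(\eta)$ for all $\xi\in\mathfrak g$, $\eta\in\mathfrak h$. Extended actions. The infinitesimal action $\psi$ is a Lie algebra homomorphism. An extension of the $G$-action to $TM\oplus T^*M$ (extended action) is an exact Courant algebra $\pi:\mathfrak a\to\mathfrak g$ with a Courant algebra morphism $\rho:\mathfrak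 a\to\Gamma(TM\oplus T^*M)$ (i.e. $\rho([a,b])=[\rho(a),\rho(b)]_H$ and $\pi_{TM}\circ\rho=\psi\circ\pi$, where $\pi_{TM}$ is the projection to $TM$) such that $\ker\pi$ acts trivially, i.e. $[\rho(\eta),\cdot\,]_H=0$ for $\eta\in\ker\pi$, and such that the induced action of $\mathfrak g$ on $\Gamma(TM\oplus T^*M)$, $\xi\mapsto[\rho(a),\cdot\,]_H$ with $\pi(a)=\xi$, integrates to a $G$-action on $TM\oplus T^*M$.
   Formalization: The G-action on TM⊕T*M to which an extended action integrates is also required to preserve the splitting (act separately on TM and T*M); otherwise the induced action always integrates, via e^h g_* e^{-h}, and ''only if'' fails. *)

(* Defs.v *)
From HB Require Import structures.
From mathcomp Require Import all_boot all_order all_algebra ring.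
From mathcomp Require Import all_classical all_reals all_analysis.
Set Implicit Arguments.
Unset Strict Implicit.
Unset Printing Implicit Defensive.
Import Order.TTheory GRing.Theory Num.Theory numFieldNormedType.Exports.
Local Open Scope classical_set_scope.
Local Open Scope ring_scope.

Fixpoint Ck (R : realType) (n k : nat) (U : set 'rV[R]_n)
    (f : 'rV[R]_n -> R) : Prop :=
  match k with
  | 0 => forall x, U x -> {for x, continuous f}
  | k'.+1 => (forall x, U x -> differentiable f x) /\
      forall i : 'I_n, Ck k' U (fun x => 'D_(delta_mx 0 i) f x)
  end.

Definition smooth_on (R : realType) n (U : set 'rV[R]_n) (f : 'rV[R]_n -> R) :=
  forall k, Ck k U f.

Lemma near_eq_continuous_at (T U : topologicalType) (f g : T -> U) (x : T) :
  (\near x, f x = g x) -> {for x, continuous f} -> {for x, continuous g}.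
Proof.
move=> fg cf; rewrite /prop_for /continuous_at -(nbhs_singleton fg).
by apply: cvg_trans cf; exact: near_eq_cvg.
Qed.

Lemma near_eq_differentiable (R : realType) (V W : normedModType R)
  (f g : V -> W) (x : V) :
  (\near x, f x = g x) -> differentiable f x -> differentiable g x.
Proof.
move=> fg df; set k := g - f.
have kx : \near x, k x = 0.
  by near=> y; rewrite /k !fctE (near fg y)// subrr.
have kE : \forall h \near (0 : V), k (h + x) = 0.
  by move: (kx); rewrite (near_shift 0 x) subr0; apply.
move/nbhs_singleton : kx => kx.
have ko : k \o shift x = cst (k x) + (\0 : {linear V -> W}) +o_ 0 id.
  apply/eqaddoP => e e0; near=> h.
  rewrite !fctE /= kx (near kE h)// addr0 subrr normr0.
  by rewrite mulr_ge0// ltW.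
have cont0 : continuous (\0 : {linear V -> W}) by move=> y; exact: cvg_cst.
have dk : differentiable k x.
  by apply/diff_locallyP; rewrite (diff_unique cont0 ko); split.
have -> : g = k + f by rewrite /k subrK.
exact: differentiableD.
Unshelve. all: by end_near. Qed.

Section CkTheory.
Variables (R : realType) (n : nat).
Implicit Types (U : set 'rV[R]_n) (f g : 'rV[R]_n -> R).

Lemma Ck_eq k U f g : open U -> (forall x, U x -> f x = g x) ->
  Ck k U f -> Ck k U g.
Proof.
move=> oU; elim: k f g => [|k IH] f g fg /=.
all: have fgx x : U x -> \forall y \near x, f y = g y
  by move=> Ux; apply: filterS fg _; exact: open_nbhs_nbhs.
  move=> cf x Ux.
  by apply: (@near_eq_continuous_at 'rV[R]_n R f); [exact: fgx|exact: cf].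
move=> [df cf]; split=> [x Ux|i].
  by apply: near_eq_differentiable (df x Ux); exact: fgx.
by apply: IH (cf i) => x Ux; apply: near_eq_derive; exact: fgx.
Unshelve. all: by end_near. Qed.

Lemma CkS k U f : Ck k.+1 U f -> Ck k U f.
Proof.
elim: k f => [|k IH] f [df cf].
  by move=> x Ux; exact: differentiable_continuous (df x Ux).
by split=> // i; exact: IH (cf i).
Qed.

Lemma Ck_cst k U c : open U -> Ck k U (cst c).
Proof.
move=> oU; elim: k c => [|k IH] c; first by move=> x _; exact: (@cst_continuous 'rV[R]_n R).
split=> [x _|i]; first exact: differentiable_cst.
by apply: Ck_eq (IH 0) => // x _; rewrite derive_cst.
Qed.

Lemma CkD k U f g : open U -> Ck k U f -> Ck k U g -> Ck k U (f + g).
Proof.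
move=> oU; elim: k f g => [|k IH] f g.
  by move=> cf cg x Ux; apply: (@continuousD _ R 'rV[R]_n); [exact: cf|exact: cg].
move=> [df cf] [dg cg]; split=> [x Ux|i].
  by apply: differentiableD; [exact: df|exact: dg].
apply: Ck_eq (IH _ _ (cf i) (cg i)) => // x Ux.
by rewrite deriveD//; apply: diff_derivable; [exact: df|exact: dg].
Qed.

Lemma CkM k U f g : open U -> Ck k U f -> Ck k U g -> Ck k U (f * g).
Proof.
move=> oU; elim: k f g => [|k IH] f g.
  by move=> cf cg x Ux; apply: (@continuousM _ 'rV[R]_n); [exact: cf|exact: cg].
move=> Cf Cg; case: (Cf) (Cg) => [df cf] [dg cg]; split=> [x Ux|i].
  by apply: differentiableM; [exact: df|exact: dg].
apply: Ck_eq (CkD oU (IH _ _ (CkS Cf) (cg i)) (IH _ _ (CkS Cg) (cf i))) => //.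
move=> x Ux.
by rewrite deriveM//; apply: diff_derivable; [exact: df|exact: dg].
Qed.

End CkTheory.

(* A chart is recorded with a chosen inverse of the coordinate map; only the
   restrictions of [chart_map] to [chart_dom] and of [chart_inv] to the image
   of [chart_dom] are meaningful. *)
Record chart (R : realType) (n : nat) (M : Type) := Chart {
  chart_dom : set M;
  chart_map : M -> 'rV[R]_n;
  chart_inv : 'rV[R]_n -> M }.

Definition chart_img R n M (c : chart R n M) : set 'rV[R]_n :=
  chart_map c @` chart_dom c.

Definition is_chart R n (M : topologicalType) (c : chart R n M) :=
  [/\ open (chart_dom c), open (chart_img c),
      forall p, chart_dom c p -> chart_inv c (chart_map c p) = p,
      forall p, chart_dom c p -> {for p, continuous (chart_map c)} &
      forall x, chart_img c x -> {for x, continuous (chart_inv c)}].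

Definition is_atlas R n (M : topologicalType) (A : set (chart R n M)) :=
  [/\ forall c, A c -> is_chart c,
      forall p, exists2 c, A c & chart_dom c p &
      forall c d, A c -> A d -> forall i : 'I_n,
        smooth_on (chart_map c @` (chart_dom c `&` chart_dom d))
          (fun x => chart_map d (chart_inv c x) 0 i)].

Record manifold (R : realType) := Manifold {
  mfd_space :> topologicalType;
  mfd_dim : nat;
  mfd_atlas : set (chart R mfd_dim mfd_space);
  mfd_hausdorff : hausdorff_space mfd_space;
  mfd_second_countable : @second_countable mfd_space;
  mfd_atlasP : is_atlas mfd_atlas }.

Definition prod_chart R m n M N (c : chart R m M) (d : chart R n N) :
    chart R (m + n) (M * N) :=
  Chart (chart_dom c `*` chart_dom d)
    (fun p => row_mx (chart_map c p.1) (chart_map d p.2))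
    (fun x => (chart_inv c (lsubmx x), chart_inv d (rsubmx x))).

Definition prod_atlas R m n M N (A : set (chart R m M))
    (B : set (chart R n N)) : set (chart R (m + n) (M * N)) :=
  [set e | exists c d, [/\ A c, B d & e = prod_chart c d]].

Definition smooth_fun R n (M : Type) (A : set (chart R n M)) (f : M -> R) :=
  forall c, A c -> smooth_on (chart_img c) (f \o chart_inv c).

Definition smooth_map R m n (M N : topologicalType) (A : set (chart R m M))
    (B : set (chart R n N)) (F : M -> N) :=
  continuous F /\
  forall c d, A c -> B d -> forall i : 'I_n,
    smooth_on (chart_map c @` (chart_dom c `&` F @^-1` chart_dom d))
      (fun x => chart_map d (F (chart_inv c x)) 0 i).

Section SmoothFunctions.
Variables (R : realType) (M : manifold R).

Definition smooth_pred : {pred M -> R} :=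
  [pred f : M -> R | `[< smooth_fun (@mfd_atlas R M) f >] ].

Lemma chart_img_open (c : chart R (mfd_dim M) M) :
  mfd_atlas c -> open (chart_img c).
Proof. by move=> Ac; case: (mfd_atlasP M) => /(_ c Ac) []. Qed.

Lemma smooth_cst (a : R) : (cst a : M -> R) \in smooth_pred.
Proof. by apply/asboolP => c Ac k; apply: Ck_cst; exact: chart_img_open. Qed.

Lemma smoothD (f g : M -> R) :
  f \in smooth_pred -> g \in smooth_pred -> f + g \in smooth_pred.
Proof.
move=> /asboolP sf /asboolP sg; apply/asboolP => c Ac k.
by apply: (CkD (chart_img_open Ac)); [exact: sf|exact: sg].
Qed.

Lemma smoothM (f g : M -> R) :
  f \in smooth_pred -> g \in smooth_pred -> f * g \in smooth_pred.
Proof.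
move=> /asboolP sf /asboolP sg; apply/asboolP => c Ac k.
by apply: (CkM (chart_img_open Ac)); [exact: sf|exact: sg].
Qed.

Lemma smoothZ (a : R) (f : M -> R) :
  f \in smooth_pred -> a *: f \in smooth_pred.
Proof. by move=> sf; exact: smoothM (smooth_cst a) sf. Qed.

Lemma smooth_subring : GRing.subring_closed smooth_pred.
Proof.
split=> [|f g sf sg|]; [exact: smooth_cst| |exact: smoothM].
by apply: smoothD => //; rewrite -scaleN1r; exact: smoothZ.
Qed.

HB.instance Definition _ := GRing.isSubringClosed.Build (M -> R) smooth_pred
  smooth_subring.
HB.instance Definition _ := GRing.isScaleClosed.Build R (M -> R) smooth_pred
  smoothZ.

Record Cinf := MkCinf {
  cinf_val :> M -> R; cinf_valP : cinf_val \in smooth_pred }.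

HB.instance Definition _ := [isSub for cinf_val].
HB.instance Definition _ := [Choice of Cinf by <:].
HB.instance Definition _ := 
  GRing.SubChoice_isSubComPzRing.Build _ _ Cinf smooth_subring.
HB.instance Definition _ := [SubZmodule_isSubLmodule of Cinf by <:].

End SmoothFunctions.

Section VectorFields.
Variables (R : realType) (M : manifold R).
Local Notation C := (Cinf M).
Implicit Types (f g : C) (a : R).

Definition cinf_cst a : C := MkCinf (smooth_cst M a).

Lemma cinf_scaleE a f : a *: f = cinf_cst a * f.
Proof. exact/val_inj. Qed.

(* Vector fields are identified with the derivations of the algebra of smooth
   functions. *)
Definition derivation_pred : {pred C -> C} :=
  [pred D : C -> C |
    `[< linear D /\ forall f g, D (f * g) = D f * g + f * D g >] ].

Lemma derivation_submod : GRing.submod_closed derivation_pred.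
Proof.
split=> [|a D E /asboolP[lD mD] /asboolP[lE mE]]; apply/asboolP; split.
- by move=> b f g; rewrite scaler0 addr0.
- by move=> f g; rewrite mul0r mulr0 addr0.
- by move=> b f g; rewrite !fctE lD lE !cinf_scaleE; ring.
- by move=> f g; rewrite !fctE mD mE !cinf_scaleE; ring.
Qed.

HB.instance Definition _ :=
  GRing.isSubmodClosed.Build R (C -> C) derivation_pred derivation_submod.

Record vfield := MkVfield {
  vfield_val :> C -> C;
  vfield_valP : vfield_val \in derivation_pred }.

HB.instance Definition _ := [isSub for vfield_val].
HB.instance Definition _ := [Choice of vfield by <:].
HB.instance Definition _ := [SubChoice_isSubLmodule of vfield by <:].

Implicit Types X Y Z : vfield.

Lemma vfieldP X : linear X /\ forall f g, X (f * g) = X f * g + f * X g.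
Proof. exact/asboolP/vfield_valP. Qed.

Lemma vf_linear X : linear X. Proof. by case: (vfieldP X). Qed.

Lemma vfM X f g : X (f * g) = X f * g + f * X g.
Proof. by case: (vfieldP X). Qed.

Lemma vfD X f g : X (f + g) = X f + X g.
Proof. by have := vf_linear X 1 f g; rewrite !scale1r. Qed.

Lemma vf0 X : X 0 = 0.
Proof. by apply: (@addrI _ (X 0)); rewrite -vfD !addr0. Qed.

Lemma vfZ X a f : X (a *: f) = a *: X f.
Proof. by have := vf_linear X a f 0; rewrite vf0 !addr0. Qed.

Lemma vfN X f : X (- f) = - X f.
Proof. by rewrite -scaleN1r vfZ scaleN1r. Qed.

Lemma vfB X f g : X (f - g) = X f - X g.
Proof. by rewrite vfD vfN. Qed.

Lemma vfield_eqP X Y : (forall f, X f = Y f) -> X = Y.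
Proof. by move=> XY; apply/val_inj/funext. Qed.

Lemma vfscale_subproof f X : (fun g => f * X g) \in derivation_pred.
Proof.
apply/asboolP; split=> [a g h|g h]; first by rewrite vf_linear !cinf_scaleE; ring.
by rewrite vfM; ring.
Qed.
Definition vfscale f X : vfield := MkVfield (vfscale_subproof f X).

Lemma vfbracket_subproof X Y :
  (fun f => X (Y f) - Y (X f)) \in derivation_pred.
Proof.
apply/asboolP; split=> [a f g|f g].
  by rewrite !(vfD, vfZ) scalerBr; rewrite !cinf_scaleE; ring.
by rewrite !(vfM, vfD); ring.
Qed.
Definition vfbracket X Y : vfield := MkVfield (vfbracket_subproof X Y).

Lemma vfbracketDl X Y Z :
  vfbracket (X + Y) Z = vfbracket X Z + vfbracket Y Z.
Proof. by apply: vfield_eqP => f /=; rewrite !fctE vfD; ring. Qed.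

Lemma vfbracketC X Y : vfbracket X Y = - vfbracket Y X.
Proof. by apply: vfield_eqP => f /=; rewrite opprB. Qed.

Lemma vfbracketDr X Y Z :
  vfbracket X (Y + Z) = vfbracket X Y + vfbracket X Z.
Proof. by rewrite vfbracketC vfbracketDl opprD -!vfbracketC. Qed.

Lemma vfbracket_scalel f X Y :
  vfbracket (vfscale f X) Y = vfscale (- Y f) X + vfscale f (vfbracket X Y).
Proof. by apply: vfield_eqP => g /=; rewrite !fctE vfM; ring. Qed.

Lemma vfbracket_scaler f X Y :
  vfbracket X (vfscale f Y) = vfscale (X f) Y + vfscale f (vfbracket X Y).
Proof. by apply: vfield_eqP => g /=; rewrite !fctE vfM; ring. Qed.

Lemma vfbracket_linearl Y : linear (vfbracket^~ Y).
Proof.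
move=> a X Z; apply: vfield_eqP => f /=.
by rewrite !fctE vfD vfZ !cinf_scaleE; ring.
Qed.

Lemma vfbracket_linearr X : linear (vfbracket X).
Proof.
move=> a Y Z; apply: vfield_eqP => f /=.
by rewrite !fctE vfD vfZ !cinf_scaleE; ring.
Qed.

Lemma vfbracket_leib X Y Z :
  vfbracket X (vfbracket Y Z) =
  vfbracket (vfbracket X Y) Z + vfbracket Y (vfbracket X Z).
Proof. by apply: vfield_eqP => f /=; rewrite !fctE /= !vfB; ring. Qed.

Lemma vfbracketxx X : vfbracket X X = 0.
Proof. by apply: vfield_eqP => f /=; rewrite subrr. Qed.

End VectorFields.

(* A k-form is identified with the alternating map, multilinear over smooth
   functions, that it induces on k vector fields. *)
Section Forms.
Variables (R : realType) (M : manifold R).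
Local Notation C := (Cinf M).
Local Notation V := (vfield M).
Implicit Types (f : C) (X Y Z W : V).

Definition Cinf_linear (u : V -> C) :=
  forall f X Y, u (vfscale f X + Y) = f * u X + u Y.

Definition form1_pred : {pred V -> C} :=
  [pred al : V -> C | `[< Cinf_linear al >] ].

Definition form2_pred : {pred V -> V -> C} :=
  [pred w : V -> V -> C |
    `[< [/\ forall Y, Cinf_linear (fun X => w X Y),
            forall X, Cinf_linear (w X) & forall X, w X X = 0] >] ].

Definition form3_pred : {pred V -> V -> V -> C} :=
  [pred w : V -> V -> V -> C |
    `[< [/\ forall Y Z, Cinf_linear (fun X => w X Y Z),
            forall X Z, Cinf_linear (fun Y => w X Y Z),
            forall X Y, Cinf_linear (w X Y),
            forall X Y, w X X Y = 0 & forall X Y, w X Y Y = 0] >] ].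

Lemma Cinf_linear0 : Cinf_linear (fun=> 0).
Proof. by move=> f X Y; rewrite mulr0 addr0. Qed.

Lemma Cinf_linearZD (a : R) u v :
  Cinf_linear u -> Cinf_linear v -> Cinf_linear (fun X => a *: u X + v X).
Proof. by move=> lu lv f X Y; rewrite lu lv !cinf_scaleE; ring. Qed.

Lemma form1_submod : GRing.submod_closed form1_pred.
Proof.
split=> [|a al be /asboolP la /asboolP lb]; apply/asboolP.
  exact: Cinf_linear0.
exact: Cinf_linearZD.
Qed.

Lemma form2_submod : GRing.submod_closed form2_pred.
Proof.
split=> [|a al be /asboolP[la1 la2 la0] /asboolP[lb1 lb2 lb0]]; apply/asboolP.
  by split=> // X; exact: Cinf_linear0.
split=> [Y|X|X].
- exact: Cinf_linearZD (la1 Y) (lb1 Y).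
- exact: Cinf_linearZD (la2 X) (lb2 X).
- by rewrite !fctE la0 lb0 scaler0 addr0.
Qed.

Lemma form3_submod : GRing.submod_closed form3_pred.
Proof.
split=> [|a al be /asboolP[la1 la2 la3 la0 la0']
                  /asboolP[lb1 lb2 lb3 lb0 lb0']]; apply/asboolP.
  by split=> // X Y; exact: Cinf_linear0.
split=> [Y Z|X Z|X Y|X Y|X Y].
- exact: Cinf_linearZD (la1 Y Z) (lb1 Y Z).
- exact: Cinf_linearZD (la2 X Z) (lb2 X Z).
- exact: Cinf_linearZD (la3 X Y) (lb3 X Y).
- by rewrite !fctE la0 lb0 scaler0 addr0.
- by rewrite !fctE la0' lb0' scaler0 addr0.
Qed.

HB.instance Definition _ :=
  GRing.isSubmodClosed.Build R (V -> C) form1_pred form1_submod.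
HB.instance Definition _ :=
  GRing.isSubmodClosed.Build R (V -> V -> C) form2_pred form2_submod.
HB.instance Definition _ :=
  GRing.isSubmodClosed.Build R (V -> V -> V -> C) form3_pred form3_submod.

Record form1 := MkForm1 {
  form1_val :> V -> C; form1_valP : form1_val \in form1_pred }.
Record form2 := MkForm2 {
  form2_val :> V -> V -> C; form2_valP : form2_val \in form2_pred }.
Record form3 := MkForm3 {
  form3_val :> V -> V -> V -> C; form3_valP : form3_val \in form3_pred }.

HB.instance Definition _ := [isSub for form1_val].
HB.instance Definition _ := [Choice of form1 by <:].
HB.instance Definition _ := [SubChoice_isSubLmodule of form1 by <:].
HB.instance Definition _ := [isSub for form2_val].
HB.instance Definition _ := [Choice of form2 by <:].
HB.instance Definition _ := [SubChoice_isSubLmodule of form2 by <:].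
HB.instance Definition _ := [isSub for form3_val].
HB.instance Definition _ := [Choice of form3 by <:].
HB.instance Definition _ := [SubChoice_isSubLmodule of form3 by <:].

Implicit Types (al be : form1) (w : form2) (H : form3).

Lemma form1P al : Cinf_linear al.
Proof. exact/asboolP/form1_valP. Qed.

Lemma form2P w : [/\ forall Y, Cinf_linear (fun X => w X Y),
  forall X, Cinf_linear (w X) & forall X, w X X = 0].
Proof. exact/asboolP/form2_valP. Qed.

Lemma form3P H : [/\ forall Y Z, Cinf_linear (fun X => H X Y Z),
  forall X Z, Cinf_linear (fun Y => H X Y Z),
  forall X Y, Cinf_linear (H X Y),
  forall X Y, H X X Y = 0 & forall X Y, H X Y Y = 0].
Proof. exact/asboolP/form3_valP. Qed.

Lemma vf_addE X Y f : (X + Y) f = X f + Y f.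
Proof. by []. Qed.

Lemma vfscale1 X : vfscale 1 X = X.
Proof. by apply: vfield_eqP => f /=; rewrite mul1r. Qed.

Lemma Cinf_linear_D u X Y : Cinf_linear u -> u (X + Y) = u X + u Y.
Proof. by move=> lu; rewrite -[X in X + Y]vfscale1 lu mul1r. Qed.

Lemma Cinf_linear_0 u : Cinf_linear u -> u 0 = 0.
Proof.
by move=> lu; apply: (@addrI _ (u 0)); rewrite -Cinf_linear_D ?addr0.
Qed.

Lemma Cinf_linear_scale u f X : Cinf_linear u -> u (vfscale f X) = f * u X.
Proof. by move=> lu; rewrite -[vfscale f X]addr0 lu Cinf_linear_0// addr0. Qed.

Lemma Cinf_linearP u : (forall X Y, u (X + Y) = u X + u Y) ->
  (forall f X, u (vfscale f X) = f * u X) -> Cinf_linear u.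
Proof. by move=> uD uM f X Y; rewrite uD uM. Qed.

Lemma form1D al X Y : al (X + Y) = al X + al Y.
Proof. exact/Cinf_linear_D/form1P. Qed.

Lemma form1M al f X : al (vfscale f X) = f * al X.
Proof. exact/Cinf_linear_scale/form1P. Qed.

Lemma form2Dl w X Y Z : w (X + Y) Z = w X Z + w Y Z.
Proof. by case: (form2P w) => /(_ Z)/Cinf_linear_D. Qed.

Lemma form2Dr w X Y Z : w X (Y + Z) = w X Y + w X Z.
Proof. by case: (form2P w) => _ /(_ X)/Cinf_linear_D. Qed.

Lemma form2Ml w f X Y : w (vfscale f X) Y = f * w X Y.
Proof. by case: (form2P w) => /(_ Y)/Cinf_linear_scale. Qed.

Lemma form2Mr w f X Y : w X (vfscale f Y) = f * w X Y.
Proof. by case: (form2P w) => _ /(_ X)/Cinf_linear_scale. Qed.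

Lemma form2xx w X : w X X = 0.
Proof. by case: (form2P w). Qed.

Lemma form2C w X Y : w X Y = - w Y X.
Proof.
have := form2xx w (X + Y); rewrite form2Dl !form2Dr !form2xx add0r addr0.
by move/eqP; rewrite addr_eq0 => /eqP.
Qed.

(* [d0], [d1], [d2] are the exterior derivative (Koszul formula) on forms of
   degree 0, 1, 2; [i2] and [i3] contract a 2-form or a 3-form in its first
   argument; [lie1] and [lie2] are Lie derivatives of 1- and 2-forms. *)
Lemma d0_subproof f : (fun X => X f) \in form1_pred.
Proof. by apply/asboolP => g X Y. Qed.
Definition d0 f : form1 := MkForm1 (d0_subproof f).

Lemma d1_subproof al :
  (fun X Y => X (al Y) - Y (al X) - al (vfbracket X Y)) \in form2_pred.
Proof.
apply/asboolP; split=> [Y|X|X].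
- apply: Cinf_linearP => [X Z|f X].
    by rewrite vfbracketDl !form1D !vf_addE vfD; ring.
  by rewrite vfbracket_scalel form1D !form1M /= vfM; ring.
- apply: Cinf_linearP => [Y Z|f Y].
    by rewrite vfbracketDr !form1D !vf_addE vfD; ring.
  by rewrite vfbracket_scaler form1D !form1M /= vfM; ring.
- rewrite vfbracketxx subrr sub0r.
  by rewrite (Cinf_linear_0 (form1P al)) oppr0.
Qed.
Definition d1 al : form2 := MkForm2 (d1_subproof al).

Lemma d2_subproof w :
  (fun X Y Z => X (w Y Z) - Y (w X Z) + Z (w X Y)
     - w (vfbracket X Y) Z + w (vfbracket X Z) Y - w (vfbracket Y Z) X)
    \in form3_pred.
Proof.
apply/asboolP; split=> [Y Z|X Z|X Y|X Y|X Y].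
- apply: Cinf_linearP => [X X'|f X].
    by rewrite !vfbracketDl !(form2Dl, form2Dr) !vf_addE !vfD; ring.
  rewrite !vfbracket_scalel !(form2Dl, form2Dr) !(form2Ml, form2Mr) /= !vfM.
  by ring.
- apply: Cinf_linearP => [Y Y'|f Y].
    by rewrite !(vfbracketDl, vfbracketDr) !(form2Dl, form2Dr) !vf_addE !vfD; ring.
  rewrite !(vfbracket_scalel, vfbracket_scaler) !(form2Dl, form2Dr).
  rewrite !(form2Ml, form2Mr) /= !vfM.
  by rewrite (form2C w Y X); ring.
- apply: Cinf_linearP => [Z Z'|f Z].
    by rewrite !vfbracketDr !(form2Dl, form2Dr) !vf_addE !vfD; ring.
  rewrite !vfbracket_scaler !(form2Dl, form2Dr).
  rewrite !(form2Ml, form2Mr) /= !vfM.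
  by rewrite (form2C w Z X) (form2C w Z Y); ring.
- rewrite vfbracketxx form2xx vf0.
  have -> : w 0 Y = 0.
    by case: (form2P w) => /(_ Y)/Cinf_linear_0.
  by ring.
- rewrite vfbracketxx form2xx vf0.
  have -> : w 0 X = 0.
    by case: (form2P w) => /(_ X)/Cinf_linear_0.
  by ring.
Qed.
Definition d2 w : form3 := MkForm3 (d2_subproof w).

Lemma i2_subproof X w : w X \in form1_pred.
Proof. by apply/asboolP; case: (form2P w). Qed.
Definition i2 X w : form1 := MkForm1 (i2_subproof X w).

Lemma i3_subproof X H : H X \in form2_pred.
Proof. by apply/asboolP; case: (form3P H) => ? H2 H3 ? H0; split. Qed.
Definition i3 X H : form2 := MkForm2 (i3_subproof X H).

Lemma lie1_subproof X al :
  (fun Y => X (al Y) - al (vfbracket X Y)) \in form1_pred.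
Proof.
apply/asboolP/Cinf_linearP => [Y Z|f Y].
  by rewrite vfbracketDr !form1D vfD; ring.
by rewrite vfbracket_scaler form1D !form1M vfM; ring.
Qed.
Definition lie1 X al : form1 := MkForm1 (lie1_subproof X al).

Lemma lie2_subproof X w :
  (fun Y Z => X (w Y Z) - w (vfbracket X Y) Z - w Y (vfbracket X Z))
    \in form2_pred.
Proof.
apply/asboolP; split=> [Z|Y|Y].
- apply: Cinf_linearP => [Y Y'|f Y].
    by rewrite vfbracketDr !form2Dl vfD; ring.
  by rewrite vfbracket_scaler !form2Dl !form2Ml vfM; ring.
- apply: Cinf_linearP => [Z Z'|f Z].
    by rewrite vfbracketDr !form2Dr vfD; ring.
  by rewrite vfbracket_scaler !form2Dr !form2Mr vfM; ring.
- by rewrite form2xx vf0 sub0r (form2C w Y); ring.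
Qed.
Definition lie2 X w : form2 := MkForm2 (lie2_subproof X w).

Lemma f1scale_subproof f al : (fun X => f * al X) \in form1_pred.
Proof.
by apply/asboolP/Cinf_linearP => [X Y|g X]; rewrite ?form1D ?form1M; ring.
Qed.
Definition f1scale f al : form1 := MkForm1 (f1scale_subproof f al).

(* The sections of the direct sum of the tangent and cotangent bundles. *)
Definition gsection : Type := (V * form1)%type.
HB.instance Definition _ := GRing.Lmodule.on gsection.

Definition gscale f (s : gsection) : gsection :=
  (vfscale f s.1, f1scale f s.2).

Definition dorfman H (s t : gsection) : gsection :=
  (vfbracket s.1 t.1, lie1 s.1 t.2 - i2 t.1 (d1 s.2) - i2 t.1 (i3 s.1 H)).

End Forms.

Record leibniz (R : realType) := Leibniz {
  lb_space :> lmodType R;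
  lb_br : lb_space -> lb_space -> lb_space;
  lb_linearl : forall b, linear (lb_br^~ b);
  lb_linearr : forall a, linear (lb_br a);
  lb_identity : forall a b c,
    lb_br a (lb_br b c) = lb_br (lb_br a b) c + lb_br b (lb_br a c) }.

(* For an alternating bracket the Leibniz identity is the Jacobi identity. *)
Record lieAlgebra (R : realType) := LieAlgebra {
  lie_leibniz :> leibniz R;
  lie_alt : forall x : lie_leibniz, lb_br x x = 0 }.

Record lieModule (R : realType) (g : lieAlgebra R) := LieModule {
  lm_space :> lmodType R;
  lm_act : g -> lm_space -> lm_space;
  lm_linearl : forall y, linear (lm_act^~ y);
  lm_linearr : forall x, linear (lm_act x);
  lm_bracket : forall x x' y,
    lm_act (lb_br x x') y = lm_act x (lm_act x' y) - lm_act x' (lm_act x y) }.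

Record courantAlgebra (R : realType) (g : lieAlgebra R) := CourantAlgebra {
  ca_leibniz :> leibniz R;
  ca_pi : {linear ca_leibniz -> g};
  ca_pi_br : forall a b, ca_pi (lb_br a b) = lb_br (ca_pi a) (ca_pi b) }.

Definition exact_courant R (g : lieAlgebra R) (a : courantAlgebra g) :=
  (forall x : g, exists u : a, ca_pi a u = x) /\
  (forall u v : a, ca_pi a u = 0 -> ca_pi a v = 0 -> lb_br u v = 0).

Section Hemisemidirect.
Variables (R : realType) (g : lieAlgebra R) (h : lieModule g).

Definition hs_space : lmodType R := (g * h)%type.

Definition hs_br (u v : hs_space) : hs_space :=
  (lb_br u.1 v.1, lm_act u.1 v.2).

Lemma hs_linearl v : linear (hs_br^~ v).
Proof.
move=> a u u'; rewrite /hs_br /=.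
by rewrite (lb_linearl v.1 a) (lm_linearl v.2 a).
Qed.

Lemma hs_linearr u : linear (hs_br u).
Proof.
move=> a v v'; rewrite /hs_br /=.
by rewrite (lb_linearr u.1 a) (lm_linearr u.1 a).
Qed.

Lemma hs_identity u v w :
  hs_br u (hs_br v w) = hs_br (hs_br u v) w + hs_br v (hs_br u w).
Proof.
by rewrite /hs_br /= lb_identity lm_bracket; congr (_, _); rewrite /= subrK.
Qed.

Definition hemisemidirect_leibniz : leibniz R :=
  Leibniz hs_linearl hs_linearr hs_identity.

Lemma hs_pi_linear : linear (fst : hemisemidirect_leibniz -> g).
Proof. by []. Qed.

HB.instance Definition _ :=
  GRing.isLinear.Build R hemisemidirect_leibniz g *:%R fst hs_pi_linear.

Definition hs_pi : {linear hemisemidirect_leibniz -> g} := fst.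

Lemma hs_pi_br (u v : hemisemidirect_leibniz) :
  hs_pi (lb_br u v) = lb_br (hs_pi u) (hs_pi v).
Proof. by []. Qed.

Definition hemisemidirect : courantAlgebra g := CourantAlgebra hs_pi_br.

End Hemisemidirect.

Record lieGroup (R : realType) := LieGroup {
  lg_manifold :> manifold R;
  lg_one : lg_manifold;
  lg_mul : lg_manifold -> lg_manifold -> lg_manifold;
  lg_inv : lg_manifold -> lg_manifold;
  lg_mulA : associative lg_mul;
  lg_mul1 : left_id lg_one lg_mul;
  lg_mulV : left_inverse lg_one lg_inv lg_mul;
  lg_mul_smooth : smooth_map
    (prod_atlas (@mfd_atlas R lg_manifold) (@mfd_atlas R lg_manifold))
    (@mfd_atlas R lg_manifold) (fun p => lg_mul p.1 p.2);
  lg_inv_smooth : smooth_map (@mfd_atlas R lg_manifold)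
    (@mfd_atlas R lg_manifold) lg_inv }.

(* The Lie algebra of G: the left-invariant vector fields. *)
Section LieAlgebraOfGroup.
Variables (R : realType) (G : lieGroup R).

(* [f'] is the translate of [f]. *)
Definition left_invariant_pred : {pred vfield G} :=
  [pred X : vfield G | `[< forall (g : G) (f f' : Cinf G),
     (forall k, f' k = f (lg_mul g k)) ->
     forall k, X f' k = X f (lg_mul g k) >] ].

Lemma left_invariant_submod : GRing.submod_closed left_invariant_pred.
Proof.
split=> [|a X Y /asboolP lX /asboolP lY]; apply/asboolP => g f f' ff' k //.
have E h j : (a *: X + Y) h j = a * X h j + Y h j by [].
by rewrite !E (lX _ _ _ ff') (lY _ _ _ ff').
Qed.

HB.instance Definition _ := GRing.isSubmodClosed.Build R (vfield G)
  left_invariant_pred left_invariant_submod.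

Record lie_elt := MkLieElt {
  lie_val :> vfield G; lie_valP : lie_val \in left_invariant_pred }.

HB.instance Definition _ := [isSub for lie_val].
HB.instance Definition _ := [Choice of lie_elt by <:].
HB.instance Definition _ := [SubChoice_isSubLmodule of lie_elt by <:].

Lemma lie_br_subproof (x y : lie_elt) : vfbracket x y \in left_invariant_pred.
Proof.
have /asboolP lx := lie_valP x; have /asboolP ly := lie_valP y.
apply/asboolP => g f f' ff' k; rewrite /= !fctE.
by congr (_ - _); [apply: lx; exact: ly|apply: ly; exact: lx].
Qed.
Definition lie_br (x y : lie_elt) : lie_elt := MkLieElt (lie_br_subproof x y).

Lemma lie_br_linearl y : linear (lie_br^~ y).
Proof. by move=> a x z; apply: val_inj; exact: vfbracket_linearl. Qed.

Lemma lie_br_linearr x : linear (lie_br x).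
Proof. by move=> a y z; apply: val_inj; exact: vfbracket_linearr. Qed.

Lemma lie_br_identity x y z :
  lie_br x (lie_br y z) = lie_br (lie_br x y) z + lie_br y (lie_br x z).
Proof. by apply: val_inj; exact: vfbracket_leib. Qed.

Definition lieG_leibniz : leibniz R :=
  Leibniz lie_br_linearl lie_br_linearr lie_br_identity.

Lemma lieG_alt (x : lieG_leibniz) : lb_br x x = 0.
Proof. by apply: val_inj; exact: vfbracketxx. Qed.

Definition lieG : lieAlgebra R := LieAlgebra lieG_alt.

End LieAlgebraOfGroup.

Section ExtendedActions.
Variables (R : realType) (G : lieGroup R) (M : manifold R).
Variable act : G -> M -> M.

Definition smooth_action :=
  [/\ forall p, act (lg_one G) p = p,
      forall g k p, act (lg_mul g k) p = act g (act k p) &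
      smooth_map (prod_atlas (@mfd_atlas R G) (@mfd_atlas R M))
        (@mfd_atlas R M) (fun x => act x.1 x.2)].

(* The function [F] on G is smooth and [l] is its derivative at the identity
   in the direction [xi]. *)
Definition has_deriv1 (xi : lieG G) (F : G -> R) (l : R) :=
  exists2 f : Cinf G, (forall g, f g = F g) & lie_val xi f (lg_one G) = l.

(* X_xi is the derivative of the action (g . f)(p) = f (g^-1 p) of G on smooth
   functions; with this sign convention xi |-> X_xi preserves brackets. *)
Definition is_infinitesimal_action (psi : lieG G -> vfield M) :=
  forall xi (f : Cinf M) p,
    has_deriv1 xi (fun g => f (act (lg_inv g) p)) (psi xi f p).

(* An action of G by vector bundle automorphisms of TM (+) T*M covering the
   action on M, described on sections: [T g] is additive and maps [f s] to
   [f' (T g s)], where [f'] is the translate of [f] under g.  Smoothness is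
   tested against functions and vector fields. *)
Definition is_bundle_action (T : G -> gsection M -> gsection M) :=
  [/\ forall s, T (lg_one G) s = s,
      forall g k s, T (lg_mul g k) s = T g (T k s),
      forall g s t, T g (s + t) = T g s + T g t,
      forall g (f f' : Cinf M) s, (forall p, f' (act g p) = f p) ->
        T g (gscale f s) = gscale f' (T g s) &
      forall s,
        (forall f : Cinf M,
          smooth_fun (prod_atlas (@mfd_atlas R G) (@mfd_atlas R M))
            (fun x => (T x.1 s).1 f x.2)) /\
        (forall Y : vfield M,
          smooth_fun (prod_atlas (@mfd_atlas R G) (@mfd_atlas R M))
            (fun x => (T x.1 s).2 Y x.2))].

(* G acts on TM (+) T*M as a direct sum, i.e. through actions on TM and on T*M.
   Dropping this would also admit the conjugates of such actions by the maps
   X + al |-> X + al + i_X b, for 2-forms b that need not be invariant. *)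
Definition preserves_splitting (T : G -> gsection M -> gsection M) :=
  (forall g (X : vfield M), (T g (X, 0)).2 = 0) /\
  (forall g (al : form1 M), (T g (0, al)).1 = 0).

Definition integrates_to (T : G -> gsection M -> gsection M)
    (xi : lieG G) (D : gsection M -> gsection M) :=
  forall s p,
    (forall f : Cinf M,
      has_deriv1 xi (fun g => (T g s).1 f p) ((D s).1 f p)) /\
    (forall Y : vfield M,
      has_deriv1 xi (fun g => (T g s).2 Y p) ((D s).2 Y p)).

Definition is_courant_morphism (psi : lieG G -> vfield M) (H : form3 M)
    (a : courantAlgebra (lieG G)) (rho : a -> gsection M) :=
  [/\ linear rho,
      forall u v, rho (lb_br u v) = dorfman H (rho u) (rho v) &
      forall u, (rho u).1 = psi (ca_pi a u)].

Definition is_extended_action (psi : lieG G -> vfield M) (H : form3 M)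
    (a : courantAlgebra (lieG G)) (rho : a -> gsection M) :=
  [/\ exact_courant a,
      is_courant_morphism psi H rho,
      forall u, ca_pi a u = 0 -> forall s, dorfman H (rho u) s = 0 &
      exists T, [/\ is_bundle_action T, preserves_splitting T &
        forall u, integrates_to T (ca_pi a u) (dorfman H (rho u))]].

End ExtendedActions.

(* Main.v *)
From HB Require Import structures.
Require Import Defs.
From mathcomp Require Import all_boot all_order all_algebra ring.
From mathcomp Require Import all_classical all_reals all_analysis.
Set Implicit Arguments.
Unset Strict Implicit.
Unset Printing Implicit Defensive.
Import Order.TTheory GRing.Theory Num.Theory numFieldNormedType.Exports.
Local Open Scope classical_set_scope.
Local Open Scope ring_scope.

(* Write X for X_xi.  By Cartan's formula the bracket of rho(xi, eta) with
   Y + beta is [X, Y] + (L_X beta - i_Y L_X h), and rho preserves brackets for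
   every h.  If the action integrates to one that preserves the splitting, the
   cotangent component of the orbit of Y + 0 is constantly 0, so that its
   derivative - i_Y L_X h vanishes.  Conversely, if L_X h = 0 the action
   integrates to the natural one by push-forward, once the latter is known to be
   smooth and to have the Lie derivatives as its derivatives.

   As vector fields are abstract derivations, this rests on one principle.  By
   Hadamard's lemma and bump functions, a point derivation is a combination of
   the partial derivatives in a chart; hence a point derivation on a product
   vanishes when it kills the functions pulled back from the two factors.  This
   gives the product rule along g |-> (g, g^-1 p) and the commutation of a
   derivative in g with a derivation in p, so that neither is computed in
   coordinates. *)

(** * Functions of class C^k *)

(** The converse needs functions smooth jointly in g and p, as [is_bundle_action] requires, and
    smooth functions on G with given derivatives at 1. The obstacle is that X and al act on global
    functions and global fields only, while the action feeds them arguments that vary with g: X is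
    applied to f o g, and al to the push-forward of Y by g^-1. Each such expression is separated
    into a finite sum of products in which one factor carries the dependence on g and the other is
    X(v_i) or al(E_i) for fixed v_i and E_i; [ptder_coord] does this for fields, [form1_local] for
    forms. The dependence of the base point on g is added last, by composition with the shear (g, p)
    |-> (g, g^-1 p).

    Derivations of global functions are not local by definition, and locality is never proved on its
    own: multiplying f - f(p) by chi^2 does not change its derivative at p, because chi(p) = 1 and f
    - f(p) vanishes there.

    Hadamard's quotients must be smooth, not just continuous, since the derivation is applied to
    them too; hence the differentiation under the integral sign to all orders. *)

Section CkCalculus.
Variable R : realType.

Lemma rV_sum_delta m (T : Type) (G : T -> 'rV[R]_m) :
  G = \sum_(j < m) (fun x => G x 0 j *: delta_mx 0 j).
Proof. by apply/funext => x; rewrite fct_sumE {1}(row_sum_delta (G x)). Qed.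

Lemma rV_continuous_at m (T : topologicalType) (G : T -> 'rV[R]_m) x :
  (forall j, {for x, continuous (fun y => G y 0 j)}) -> {for x, continuous G}.
Proof.
move=> cG; rewrite (rV_sum_delta G); elim/big_ind : _ => [|f g cf cg|j _].
- exact: cvg_cst.
- exact: cvgD cf cg.
- exact: cvgZr_tmp (cG j).
Qed.

Lemma rV_differentiable m (V : normedModType R) (G : V -> 'rV[R]_m) x :
  (forall j, differentiable (fun y => G y 0 j) x) -> differentiable G x.
Proof.
move=> dG; rewrite (rV_sum_delta G); apply: differentiable_sum => j.
exact: differentiableZl.
Qed.

Lemma derive_rV_comp m (V : normedModType R) (f : 'rV[R]_m -> R)
    (G : V -> 'rV[R]_m) x v :
  (forall j, differentiable (fun y => G y 0 j) x) -> differentiable f (G x) ->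
  'D_v (f \o G) x =
  \sum_(j < m) 'D_v (fun y => G y 0 j) x * 'D_(delta_mx 0 j) f (G x).
Proof.
move=> dGj df; have dG := rV_differentiable dGj.
rewrite deriveE; last exact: differentiable_comp.
rewrite diff_comp//= -(deriveE v dG) derive_mx; last exact: diff_derivable.
rewrite [X in 'd f (G x) X]row_sum_delta linear_sum; apply: eq_bigr => j _.
by rewrite linearZ mxE/= (deriveE _ df).
Qed.

(** [Ck] asks for ambient derivatives at the points of U, so it passes to arbitrary subsets, open or
    not. *)
Lemma Ck_sub n k (U V : set 'rV[R]_n) f : U `<=` V -> Ck k V f -> Ck k U f.
Proof.
move=> UV; elim: k f => [|k IH] f /=; first by move=> cf x /UV; exact: cf.
by move=> [df cf]; split=> [x /UV|i]; [exact: df|exact: IH].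
Qed.

Lemma Ck_cover n k (U : set 'rV[R]_n) f :
  (forall x, U x -> exists2 V : set 'rV[R]_n, V x & Ck k V f) -> Ck k U f.
Proof.
elim: k f => [|k IH] f cf /=.
  by move=> x Ux; have [V Vx] := cf x Ux; exact.
split=> [x Ux|i]; first by have [V Vx [df _]] := cf x Ux; exact: df.
by apply: IH => x Ux; have [V Vx [_ cV]] := cf x Ux; exists V => //; exact: cV.
Qed.

Lemma Ck_locally n k (U : set 'rV[R]_n) f :
  (forall x, U x -> exists V g,
    [/\ open V, V x, forall y, V y -> g y = f y & Ck k V g]) -> Ck k U f.
Proof.
move=> cf; apply: Ck_cover => x /cf[V [g [oV Vx gf cg]]].
by exists V => //; exact: Ck_eq cg.
Qed.

Lemma Ck_sum n k (U : set 'rV[R]_n) (I : Type) (r : seq I) (P : pred I)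
    (F : I -> 'rV[R]_n -> R) : open U ->
  (forall i, P i -> Ck k U (F i)) -> Ck k U (\sum_(i <- r | P i) F i).
Proof.
by move=> oU cF; elim/big_ind : _ => //; [exact: Ck_cst|move=> *; exact: CkD].
Qed.

(** Induction on k: by the chain rule a partial derivative of f o G is a sum of products of a
    derivative of G_j with (D_j f) o G, and the induction hypothesis applies to D_j f in place of
    f. *)
Lemma Ck_comp n m k (U : set 'rV[R]_n) (V : set 'rV[R]_m) f G :
  open U -> open V -> (forall x, U x -> V (G x)) ->
  (forall j, Ck k U (fun x => G x 0 j)) -> Ck k V f -> Ck k U (f \o G).
Proof.
move=> oU oV UV; elim: k f => [|k IH] f cG cf.
  move=> x Ux; apply: continuous_comp; last exact/cf/UV.
  by apply: rV_continuous_at => j; exact: cG.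
have dG x j : U x -> differentiable (fun y => G y 0 j) x.
  by have [dG _] := cG j; exact: dG.
case: cf => [df cf]; split=> [x Ux|i].
  apply: differentiable_comp; last exact/df/UV.
  by apply: rV_differentiable => j; exact: dG.
apply: (@Ck_eq _ _ _ _ (\sum_(j < m)
   (fun x => 'D_(delta_mx 0 i) (fun y => G y 0 j) x) *
   ((fun y => 'D_(delta_mx 0 j) f y) \o G))) => //.
  move=> x Ux; rewrite derive_rV_comp; [|by move=> j; exact: dG|exact/df/UV].
  by rewrite fct_sumE.
apply: Ck_sum => // j _; apply: CkM => //; first by case: (cG j) => _ /(_ i).
by apply: IH => [j'|]; [exact: CkS|exact: cf].
Qed.

Lemma derive_coord n (v : 'rV[R]_n) (j : 'I_n) (x : 'rV[R]_n) :
  'D_v (fun y : 'rV[R]_n => y 0 j) x = v 0 j.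
Proof.
have := @derive_mx _ _ _ _ id x v (@derivable_id _ _ x v).
by rewrite derive_id => /rowP/(_ j); rewrite mxE.
Qed.

Lemma Ck_coord n k (U : set 'rV[R]_n) (j : 'I_n) : open U ->
  Ck k U (fun x => x 0 j).
Proof.
move=> oU; case: k => [|k]; first by move=> x _; exact: coord_continuous.
split=> [x _|i]; first exact: differentiable_coord.
by apply: Ck_eq (Ck_cst k (delta_mx 0 i 0 j) oU) => // x _; rewrite derive_coord.
Qed.

End CkCalculus.

(** * Bump functions *)

Section FlatExp.
Variable R : realType.

(* The functions t^-n e^(-1/t) form a family closed under differentiation, so
   that all of them are smooth by a single induction. *)
Definition flat_exp (n : nat) (t : R) : R :=
  if 0 < t then t^-1 ^+ n * expR (- t^-1) else 0.

Lemma flat_exp_ge0 n t : 0 <= flat_exp n t.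
Proof.
rewrite /flat_exp; case: ifPn => // t0.
by rewrite mulr_ge0 ?expR_ge0// exprn_ge0// invr_ge0 ltW.
Qed.

(** With y = 1/t the bound reads y^(n+1) <= (n+1)! e^y, one term of the exponential series. A bound
    linear in t, available for every n, is what makes the derivatives at 0 vanish. *)
Lemma flat_exp_le n t : flat_exp n t <= n.+1`!%:R * `|t|.
Proof.
rewrite /flat_exp; case: ifPn => [t0|_]; last by rewrite mulr_ge0.
rewrite gtr0_norm//; set y := t^-1; have y0 : 0 < y by rewrite invr_gt0.
have -> : t = y^-1 by rewrite invrK.
rewrite expRN ler_pdivrMr ?expR_gt0// mulrAC ler_pdivlMr// -exprSr.
have f0 : 0 < n.+1`!%:R :> R by rewrite ltr0n fact_gt0.
rewrite -ler_pdivrMl// mulrC.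
by apply: le_trans (expR_ge1Dxn n (ltW y0)); rewrite lerDr.
Qed.

Lemma flat_exp0 n t : t <= 0 -> flat_exp n t = 0.
Proof. by rewrite /flat_exp ltNge => ->. Qed.

Lemma flat_expS n t : t^-1 * flat_exp n t = flat_exp n.+1 t.
Proof. by rewrite /flat_exp; case: ifP; rewrite ?mulr0// exprS mulrA. Qed.

Lemma is_derive_flat_exp (n : nat) (t : R) :
  is_derive t (1 : R) (flat_exp n) (flat_exp n.+2 t - n%:R * flat_exp n.+1 t).
Proof.
have [t0|t0|->] := ltgtP t 0.
- rewrite !flat_exp0 ?ltW// mulr0 subr0.
  apply: (near_eq_is_derive (f := cst 0)) => //.
  by near=> s; rewrite flat_exp0// ltW//; near: s; exact: lt_nbhsl.
- rewrite /flat_exp t0.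
  apply: (near_eq_is_derive (f := fun s : R => s^-1 ^+ n * expR (- s^-1))).
    by near=> s; rewrite ifT//; near: s; exact: lt_nbhsr.
  have tn0 : t != 0 by rewrite gt_eqF.
  have dV : is_derive t 1 (fun s : R => s^-1) (- t^-2).
    have := is_deriveV tn0 (is_derive_id t (1 : R)).
    by rewrite /GRing.scale/= mulr1.
  have dE : is_derive t 1 (fun s : R => expR (- s^-1)) (expR (- t^-1) * t^-2).
    apply: is_derive1_comp.
    by have := is_deriveN dV; rewrite opprK.
  have := is_deriveM (is_deriveX n dV) dE.
  move=> D; rewrite (_ : (fun _ => _) =
      (fun s : R => s^-1) ^+ n * (fun s => expR (- s^-1))); last first.
    by apply/funext => s; rewrite !fctE.
  apply: (is_derive_eq D); rewrite /GRing.scale/= !fctE -!exprVn.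
  by case: n {D} => [|n] /=; move: (t^-1) (expR _) => y E; rewrite !exprS; ring.
(* At 0 the difference quotient of [flat_exp n] is [flat_exp n.+1 h] by [flat_expS], also for h < 0;
   the linear bound for n+1 sends it to 0, whence the constant (n+2)!. *)
- rewrite !flat_exp0// mulr0 subr0.
  suff D : h^-1 *: (flat_exp n (h *: (1 : R) + 0) - flat_exp n 0) @[h --> 0^']
      --> (0 : R).
    by apply: DeriveDef; [exact: cvgP D|exact: cvg_lim D].
  have K0 : 0 < n.+2`!%:R :> R by rewrite ltr0n fact_gt0.
  apply/cvgrPdist_lt => e e0; near=> h.
  rewrite sub0r normrN addr0 (flat_exp0 _ (lexx _)) subr0 /GRing.scale/= mulr1.
  rewrite flat_expS ger0_norm ?flat_exp_ge0//.
  rewrite (le_lt_trans (flat_exp_le _ _))// -ltr_pdivlMl// mulrC.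
  by near: h; apply: dnbhs0_lt; rewrite divr_gt0.
Unshelve. all: by end_near. Qed.

Lemma flat_exp_differentiable n (t : R) : differentiable (flat_exp n) t.
Proof. by apply/derivable1_diffP; case: (is_derive_flat_exp n t). Qed.

Lemma Ck_flat_exp m k (U : set 'rV[R]_m) n (u : 'rV[R]_m -> R) :
  open U -> Ck k U u -> Ck k U (flat_exp n \o u).
Proof.
move=> oU; elim: k n => [|k IH] n Cu.
  move=> x Ux; apply: continuous_comp; first exact: Cu.
  exact/differentiable_continuous/flat_exp_differentiable.
have [du cu] := Cu; split=> [x Ux|i].
  by apply: differentiable_comp; [exact: du|exact: flat_exp_differentiable].
apply: (@Ck_eq _ _ _ _ ((fun x => 'D_(delta_mx 0 i) u x) *
  ((flat_exp n.+2 \o u) + cst (- n%:R) * (flat_exp n.+1 \o u)))) => //.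
  move=> x Ux; have du' := du x Ux.
  have df := flat_exp_differentiable n (u x).
  rewrite deriveE; last exact: differentiable_comp.
  rewrite diff_comp//= -(deriveE _ du') deriv1E; last exact/derivable1_diffP.
  have [_ D] := is_derive_flat_exp n (u x).
  by rewrite derive1E D !fctE mulNr.
apply: (CkM oU (cu i)); apply: (CkD oU (IH _ (CkS Cu))).
exact: (CkM oU (Ck_cst _ _ oU) (IH _ (CkS Cu))).
Qed.

(* With E t = e^(-1/t), extended by 0: the inner E t vanishes for t <= 0 and is
   at least E r for t >= r. *)
Definition plateau (r t : R) : R :=
  (flat_exp 0 (flat_exp 0 r))^-1 * flat_exp 0 (flat_exp 0 r - flat_exp 0 t).

Lemma flat_exp_gt0 n t : 0 < t -> 0 < flat_exp n t.
Proof.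
by move=> t0; rewrite /flat_exp t0 mulr_gt0 ?expR_gt0// exprn_gt0// invr_gt0.
Qed.

Lemma plateau1 r t : 0 < r -> t <= 0 -> plateau r t = 1.
Proof.
move=> r0 t0; rewrite /plateau (flat_exp0 _ t0) subr0 mulVf// gt_eqF//.
by rewrite !flat_exp_gt0.
Qed.

Lemma plateau0 r t : 0 < r -> r <= t -> plateau r t = 0.
Proof.
move=> r0 rt; rewrite /plateau [X in _ * X]flat_exp0 ?mulr0// subr_le0.
have t0 := lt_le_trans r0 rt.
by rewrite /flat_exp r0 t0 !expr0 !mul1r ler_expR lerN2 lef_pV2.
Qed.

Lemma Ck_plateau m k (U : set 'rV[R]_m) r (u : 'rV[R]_m -> R) :
  open U -> Ck k U u -> Ck k U (plateau r \o u).
Proof.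
move=> oU cu; have -> : plateau r \o u =
    cst (flat_exp 0 (flat_exp 0 r))^-1 * (flat_exp 0 \o
      (cst (flat_exp 0 r) + cst (-1) * (flat_exp 0 \o u))).
  by apply/funext => x; rewrite !fctE mulN1r.
apply: (CkM oU (Ck_cst _ _ oU)); apply: Ck_flat_exp => //.
apply: (CkD oU (Ck_cst _ _ oU)); apply: (CkM oU (Ck_cst _ _ oU)).
exact: Ck_flat_exp.
Qed.

Lemma rV_bump n (y : 'rV[R]_n) (r : R) : 0 < r -> exists chi : 'rV[R]_n -> R,
  [/\ smooth_on setT chi, forall x, r <= `|x - y| -> chi x = 0 &
      \forall x \near y, chi x = 1].
Proof.
(* The norm is the maximum norm, which is not smooth, so the bump is a function of the sum of
   squares s. As s dominates the squared norm, |x - y| >= r forces s >= r^2; the plateau of width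
   r^2/2 taken at s - r^2/2 is then 0, and it is 1 while s <= r^2/2. *)
move=> r0; pose s : 'rV[R]_n -> R :=
  \sum_(i < n) (fun x : 'rV[R]_n => x 0 i + - y 0 i) *
               (fun x : 'rV[R]_n => x 0 i + - y 0 i).
have q0 : 0 < r ^+ 2 / 2 by rewrite divr_gt0// exprn_gt0.
have sE x : s x = \sum_(i < n) ((x - y) 0 i) ^+ 2.
  by rewrite /s fct_sumE; apply: eq_bigr => i _; rewrite !mxE.
have cs k : Ck k setT s.
  apply: Ck_sum => [|i _]; first exact: openT.
  by apply: CkM; [exact: openT| |];
    apply: (CkD openT (Ck_coord _ _ openT) (Ck_cst _ _ openT)).
exists (plateau (r ^+ 2 / 2) \o (s + cst (- (r ^+ 2 / 2)))); split.
- move=> k; apply: (Ck_plateau _ openT); apply: (CkD openT (cs k)).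
  exact: (Ck_cst _ _ openT).
- move=> x rxy; apply: plateau0 => //.
  rewrite !fctE lerBrDr -splitr sE.
  have : exists i, r <= `|(x - y) 0 i|.
    apply: contrapT => /forallNP nr; move: rxy; rewrite leNgt => /negP; apply.
    rewrite /Num.Def.normr/= mx_normrE; apply/bigmax_ltP; split=> // -[j i] _.
    by rewrite ord1 ltNge; exact/negP/nr.
  move=> [i ri]; rewrite (bigD1 i)//= -(real_normK (num_real ((x - y) 0 i))).
  apply: ler_wpDr; first by apply: sumr_ge0 => j _; exact: sqr_ge0.
  by rewrite lerXn2r ?nnegrE// ltW.
- have cs0 : {for y, continuous s} by exact: (cs 0).
  have sy : s y < r ^+ 2 / 2 by rewrite sE big1// => i _; rewrite subrr mxE expr0n.
  near=> x; apply: plateau1 => //; rewrite !fctE subr_le0 ltW//.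
  by near: x; exact: (cs0 _ (lt_nbhsl sy)).
Unshelve. all: by end_near. Qed.
End FlatExp.

(** * Hadamard's lemma *)

Lemma diff_of_estimate (R : realType) (V W : normedModType R)
    (L : {linear V -> W}) (f : V -> W) (x : V) : continuous L ->
  (forall e : R, 0 < e ->
     \forall v \near (0 : V), `|f (v + x) - f x - L v| <= e * `|v|) ->
  differentiable f x /\ 'd f x = L :> (V -> W).
Proof.
move=> cL h; have ko : f \o shift x = cst (f x) + L +o_ 0 id.
  apply/eqaddoP => e e0; apply: filterS (h e e0) => v.
  by rewrite !fctE/= opprD addrA.
have du := diff_unique cL ko; split=> //.
by apply/diff_locallyP; rewrite du; split.
Qed.

(** * Gradients and strict differentiability *)

Section DotProduct.
Variables (R : realType) (n : nat).

Definition dotr (c : 'I_n -> R) (v : 'rV[R]_n) : R := \sum_i v 0 i * c i.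

Lemma dotr_linear c : linear (dotr c).
Proof.
move=> a u v; rewrite /dotr scaler_sumr -big_split; apply: eq_bigr => i _.
by rewrite !mxE mulrDl -mulrA.
Qed.

HB.instance Definition _ c :=
  GRing.isLinear.Build R 'rV[R]_n R _ (dotr c) (dotr_linear c).

Lemma dotr_delta c i : dotr c (delta_mx 0 i) = c i.
Proof.
rewrite /dotr (bigD1 i)//= mxE !eqxx mul1r big1 ?addr0// => j ji.
by rewrite mxE (negbTE ji) mul0r.
Qed.

Lemma continuous_dotr c : continuous (dotr c).
Proof.
move=> v; have -> : dotr c = \sum_i (fun u : 'rV[R]_n => u 0 i * c i).
  by apply/funext => u; rewrite fct_sumE.
elim/big_ind : _ => [|f g cf cg|j _].
- exact: (@cvg_cst R (0 : R) _ (nbhs v) _).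
- exact: cvgD cf cg.
- exact: (@cvgMr_tmp R _ (nbhs v) _ _ _ (c j) (@coord_continuous R 1 n 0 j v)).
Qed.

Lemma normr_coord (v : 'rV[R]_n) i : `|v 0 i| <= `|v|.
Proof.
rewrite [leRHS]/Num.Def.normr/= mx_normrE.
exact: (le_bigmax _ (fun ij : 'I_1 * 'I_n => `|v ij.1 ij.2|) (0, i)).
Qed.

Lemma dotr_le c v e : (forall i, `|c i| <= e) -> `|dotr c v| <= n%:R * e * `|v|.
Proof.
move=> ce; apply: le_trans (ler_norm_sum _ _ _) _.
rewrite -mulrA mulr_natl -[X in _ *+ X]card_ord -sumr_const; apply: ler_sum => i _.
by rewrite normrM mulrC; apply: ler_pM => //; exact: normr_coord.
Qed.

Lemma dotrB c d v : dotr c v - dotr d v = dotr (fun i => c i - d i) v.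
Proof. by rewrite /dotr -sumrB; apply: eq_bigr => i _; rewrite mulrBr. Qed.

Lemma diff_of_dotr_estimate (f : 'rV[R]_n -> R) (x : 'rV[R]_n) c :
  (forall e : R, 0 < e ->
     \forall v \near (0 : 'rV[R]_n),
       `|f (v + x) - f x - dotr c v| <= e * `|v|) ->
  differentiable f x /\ forall i, 'D_(delta_mx 0 i) f x = c i.
Proof.
move=> h; have [df du] := diff_of_estimate (@continuous_dotr c) h.
by split=> // i; rewrite deriveE// du/= dotr_delta.
Qed.

Lemma derive_dotr (f : 'rV[R]_n -> R) (x v : 'rV[R]_n) : differentiable f x ->
  'D_v f x = dotr (fun i => 'D_(delta_mx 0 i) f x) v.
Proof.
move=> df; rewrite deriveE// [X in 'd f x X]row_sum_delta linear_sum.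
by apply: eq_bigr => i _; rewrite linearZ (deriveE _ df).
Qed.

Lemma is_derive_line (f : 'rV[R]_n -> R) (a v : 'rV[R]_n) (s : R) :
  differentiable f (a + s *: v) ->
  is_derive s (1 : R) (fun s => f (a + s *: v))
    (dotr (fun i => 'D_(delta_mx 0 i) f (a + s *: v)) v).
Proof.
move=> df; pose G : R -> 'rV[R]_n := cst a + *:%R^~ v.
have D := is_diffD (is_diff_cst a s) (is_diff_scalel s v).
have dGs : differentiable G s by case: D.
have dG1 : 'd G s 1 = v by case: D => _ ->; rewrite fctE add0r scale1r.
have dfG : differentiable (f \o G) s by exact: differentiable_comp.
apply: DeriveDef; first exact/derivable1_diffP.
by rewrite deriveE// (diff_comp dGs df)/= -derive_dotr// (deriveE _ df) dG1.
Qed.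

(** Mean value theorem on the segment from p.1 to p.1 + p.2: the error is the difference of two
    gradients at points close to x. The base point is allowed to move because in a radial integral
    it depends on t, and a bound uniform in t is wanted. *)
Lemma Ck1_strict_diff (V : set 'rV[R]_n) f (x : 'rV[R]_n) (e : R) :
  open V -> V x -> Ck 1 V f -> 0 < e -> \forall p \near (x, (0 : 'rV[R]_n)),
    `|f (p.1 + p.2) - f p.1 - dotr (fun i => 'D_(delta_mx 0 i) f p.1) p.2|
      <= e * `|p.2|.
Proof.
(* Each of the n partial derivatives varies by at most e' + e', through its value at x; n+1 instead
   of n keeps the quotient meaningful in dimension 0. *)
move=> oV Vx [df cf] e0; pose e' := e / (2 * n.+1%:R).
have e'0 : 0 < e' by rewrite divr_gt0// mulr_gt0.
have [d d0 dV] : exists2 d : R, 0 < d & forall z, `|x - z| < d ->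
    V z /\ forall i, `|'D_(delta_mx 0 i) f x - 'D_(delta_mx 0 i) f z| < e'.
  have : \forall z \near x,
    V z /\ forall i, `|'D_(delta_mx 0 i) f x - 'D_(delta_mx 0 i) f z| < e'.
    apply: filterI; first exact: open_nbhs_nbhs.
    have fi i : \forall z \near x,
        `|'D_(delta_mx 0 i) f x - 'D_(delta_mx 0 i) f z| < e'.
      by have /cvgrPdist_lt/(_ _ e'0) := cf i x Vx.
    exact: filter_forall fi.
  move=> /nbhs_ballP[d /= d0 dV]; exists d => // z xz; apply: dV.
  by rewrite -ball_normE.
exists (ball x (d / 2), ball (0 : 'rV[R]_n) (d / 2)).
  by split; apply: nbhsx_ballx; rewrite divr_gt0.
move=> [a v] [/=]; rewrite -!ball_normE/= sub0r normrN => xa v0.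
have seg (s : R) : 0 <= s <= 1 -> `|x - (a + s *: v)| < d.
  move=> /andP[s0 s1]; rewrite opprD addrA (splitr d).
  apply: le_lt_trans (ler_normB _ _) _; apply: ltrD => //.
  by rewrite normrZ ger0_norm// (le_lt_trans _ v0)// ler_piMl.
pose h s := f (a + s *: v).
pose h' s := dotr (fun i => 'D_(delta_mx 0 i) f (a + s *: v)) v.
have dh (s : R) : 0 <= s <= 1 -> is_derive s (1 : R) h (h' s).
  by move=> s01; apply: is_derive_line; apply: df; have [] := dV _ (seg s s01).
have [c c01] : exists2 c : R, c \in `]0, 1[ & h 1 - h 0 = h' c * (1 - 0).
  apply: MVT => //.
    move=> s; rewrite in_itv/= => /andP[s0 s1]; apply: dh.
    by rewrite !ltW.
  apply: derivable_within_continuous => s; rewrite in_itv/= => /dh[].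
  exact.
rewrite subr0 mulr1 /h scale1r scale0r addr0 => ->; rewrite dotrB.
have c01' : 0 <= c <= 1 by move: c01; rewrite in_itv/= => /andP[/ltW-> /ltW->].
have eE : e = n.+1%:R * (e' + e').
  have : n.+1%:R != 0 :> R by rewrite pnatr_eq0.
  by rewrite /e'; move: n.+1%:R => m m0; field.
apply: (@le_trans _ _ (n%:R * (e' + e') * `|v|)); last first.
  rewrite eE; apply: ler_wpM2r => //; apply: ler_wpM2r.
    by rewrite addr_ge0 ?ltW.
  by rewrite ler_nat.
apply: dotr_le => i.
have [_ /(_ i) h1] := dV _ (seg c c01').
have [|_ /(_ i) h2] := dV a.
  by rewrite (lt_le_trans xa)// ler_piMr ?ltW// invf_lt1 ?ltr1n.
set u := 'D_ _ f _; set w := 'D_ _ f a; set z := 'D_ _ f x in h1 h2.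
rewrite -(subrKA z u); apply: le_trans (ler_normD _ _) _.
by apply: lerD; [rewrite distrC ltW|exact: ltW].
Qed.

End DotProduct.

(** * Integrals over the unit interval *)

Section UnitIntegral.
Variable R : realType.
Implicit Types (f g : R -> R) (c : R).

Definition int01 f : R := \int[lebesgue_measure]_(t in `[(0 : R), 1]) f t.

(** Continuity is two-sided even at 0 and 1. Radial integrands have it because they come from
    functions on an open ball. *)
Definition cont01 f := {in `[(0 : R), 1], continuous f}.

Lemma cont01_integrable f : cont01 f ->
  lebesgue_measure.-integrable `[(0 : R), 1] (EFin \o f).
Proof.
move=> cf; apply: continuous_compact_integrable; first exact: segment_compact.
by apply: continuous_in_subspaceT => t /set_mem; exact: cf.
Qed.

Lemma int01D f g : cont01 f -> cont01 g -> int01 (f + g) = int01 f + int01 g.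
Proof. by move=> cf cg; apply: RintegralD => //; exact: cont01_integrable. Qed.

Lemma int01Z c f : cont01 f -> int01 (c *: f) = c * int01 f.
Proof. by move=> cf; apply: RintegralZl => //; exact: cont01_integrable. Qed.

Lemma int01_cst c : int01 (cst c) = c.
Proof.
rewrite /int01 Rintegral_cst//= lebesgue_measure_itv/= lte_fin ltr01 oppr0.
by rewrite adde0 mulr1.
Qed.

Lemma cont01D f g : cont01 f -> cont01 g -> cont01 (f + g).
Proof. by move=> cf cg t t01; apply: cvgD; [exact: cf|exact: cg]. Qed.

Lemma cont01Z c f : cont01 f -> cont01 (c *: f).
Proof. by move=> cf t t01; apply: cvgZl_tmp; exact: cf. Qed.

Lemma cont01_cst c : cont01 (cst c).
Proof. by move=> t _; exact: cvg_cst. Qed.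

Lemma int01_sum (I : Type) (r : seq I) (F : I -> R -> R) :
  (forall i, cont01 (F i)) ->
  cont01 (\sum_(i <- r) F i) /\
  int01 (\sum_(i <- r) F i) = \sum_(i <- r) int01 (F i).
Proof.
move=> cF; elim: r => [|i r [cr IH]].
  by rewrite !big_nil; split; [exact: cont01_cst|exact: int01_cst].
by rewrite !big_cons int01D// IH; split=> //; exact: cont01D.
Qed.

Lemma int01_norm_le f c : cont01 f ->
  (forall t, 0 <= t <= 1 -> `|f t| <= c) -> `|int01 f| <= c.
Proof.
move=> cf fc; have fi := cont01_integrable cf.
apply: le_trans (le_normr_Rintegral _ fi) _ => //.
rewrite -[leRHS]int01_cst; apply: le_Rintegral => //.
- apply: (@cont01_integrable (fun t => `|f t|)) => t t01.
  exact: (continuous_comp (cf t t01) (@norm_continuous _ R _)).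
- by apply: cont01_integrable; exact: cont01_cst.
Qed.

Lemma int01_FTC (F f : R -> R) : cont01 f ->
  (forall t : R, 0 <= t <= 1 -> is_derive t (1 : R) F (f t)) ->
  int01 f = F 1 - F 0.
Proof.
move=> cf dF; have cF (t : R) : 0 <= t <= 1 -> F x @[x --> t] --> F t.
  move=> /dF [dFt _]; apply: differentiable_continuous.
  exact/derivable1_diffP.
rewrite /int01 /Rintegral (@continuous_FTC2 _ f F)//.
- by apply: continuous_in_subspaceT => t /set_mem; exact: cf.
- split.
  + by move=> t; rewrite in_itv/= => /andP[/ltW t0 /ltW t1];
    case: (dF t) => //; rewrite t0.
  + by apply: cvg_at_right_filter; apply: cF; rewrite lexx ler01.
  + by apply: cvg_at_left_filter; apply: cF; rewrite lexx ler01.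
- move=> t; rewrite in_itv/= => /andP[/ltW t0 /ltW t1].
  by rewrite derive1E; case: (dF t) => //; rewrite t0.
Qed.

End UnitIntegral.

(** * Radial integrals and differentiation under the integral sign *)

Section Hadamard.
Variables (R : realType) (n : nat) (y : 'rV[R]_n) (r : R).
Let B : set 'rV[R]_n := ball y r.

(* The family is closed under partial differentiation: the partial derivatives
   of radial_int a f are the functions radial_int a.+1 ('D_i f). *)
Definition radial_int (a : nat) (f : 'rV[R]_n -> R) (x : 'rV[R]_n) : R :=
  int01 (fun t => t ^+ a * f (y + t *: (x - y))).

Lemma open_ball_center : open B. Proof. exact: ball_open. Qed.

Lemma ball_star x (t : R) : B x -> 0 <= t <= 1 -> B (y + t *: (x - y)).
Proof.
rewrite /B -ball_normE/= => yx /andP[t0 t1].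
rewrite opprD addNKr normrN normrZ ger0_norm//.
by apply: le_lt_trans yx; rewrite distrC ler_piMl.
Qed.

Lemma radial_int_cont01 a f x : B x -> Ck 0 B f ->
  cont01 (fun t => t ^+ a * f (y + t *: (x - y))).
Proof.
move=> Bx cf t; rewrite in_itv/= => t01.
apply: (@cvgM _ _ (nbhs t)); first exact: exprn_continuous.
apply: (@continuous_comp R 'rV[R]_n R (fun t => y + t *: (x - y))).
  by apply: cvgD; [exact: cvg_cst|apply: cvgZr_tmp; exact: cvg_id].
exact/cf/ball_star.
Qed.

(** Moving x by v moves the point at time t by t v, which accounts for the extra factor t in the
    gradient term. Strict differentiability gives the estimate near each (t, 0), and compactness of
    [0, 1] makes the neighbourhood of v = 0 independent of t. *)
Lemma radial_int_estimate a f x (e : R) : B x -> Ck 1 B f -> 0 < e ->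
  \forall v \near (0 : 'rV[R]_n), forall t : R, 0 <= t <= 1 ->
    `|t ^+ a * f (y + t *: (v + x - y)) - t ^+ a * f (y + t *: (x - y))
      - dotr (fun i => t ^+ a.+1 * 'D_(delta_mx 0 i) f (y + t *: (x - y))) v|
    <= e * `|v|.
Proof.
move=> Bx cf e0.
have /compact_near_coveringP/near_covering_withinP K := @segment_compact R 0 1.
pose z (t : R) := y + t *: (x - y).
pose P (v : 'rV[R]_n) (t : R) :=
  `|f (z t + t *: v) - f (z t)
    - dotr (fun i => 'D_(delta_mx 0 i) f (z t)) (t *: v)| <= e * `|t *: v|.
have {K} : \forall v \near (0 : 'rV[R]_n), `[(0 : R), 1] `<=` P v.
  apply: (K _ (nbhs (0 : 'rV[R]_n)) P _) => t; rewrite /= in_itv/= => t01.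
  have S := Ck1_strict_diff open_ball_center (ball_star Bx t01) cf e0.
  pose tv : R * 'rV[R]_n := (t, 0).
  have Ftv : Filter (nbhs tv) by exact: nbhs_filter.
  have c1 : (fun p : R * 'rV[R]_n => p.1) p @[p --> tv] --> t by exact: cvg_fst.
  have c2 : (fun p : R * 'rV[R]_n => p.2) p @[p --> tv] --> (0 : 'rV[R]_n).
    exact: cvg_snd.
  have cz : z p.1 @[p --> tv] --> z t.
    by apply: cvgD; [exact: cvg_cst|exact: cvgZr_tmp c1].
  have cv : p.1 *: p.2 @[p --> tv] --> (0 : 'rV[R]_n).
    by rewrite -[X in _ --> X](scaler0 _ t); exact: (cvgZ (FF := Ftv) c1 c2).
  have Q : nbhs tv (fun p => P p.2 p.1) := cvg_pair (FF := Ftv) cz cv S.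
  by case: Q => -[A C] /= AC0 sAC; exists (A, C) => //= p pAC _; exact: sAC.
apply: filterS => v Pv t t01; have := Pv t; rewrite /= in_itv/= => /(_ t01).
have /andP[t0 t1] := t01.
have -> : y + t *: (v + x - y) = z t + t *: v.
  by rewrite /z -[v + x - y]addrA scalerDr [t *: v + _]addrC addrA.
rewrite -/(z t) /P => h.
have -> : dotr (fun i => t ^+ a.+1 * 'D_(delta_mx 0 i) f (z t)) v =
    t ^+ a * dotr (fun i => 'D_(delta_mx 0 i) f (z t)) (t *: v).
  rewrite /dotr mulr_sumr; apply: eq_bigr => i _.
  by rewrite mxE exprS; ring.
rewrite -!mulrBr normrM ger0_norm ?exprn_ge0//.
apply: (@le_trans _ _ (1 * (e * `|t *: v|))).
  by apply: ler_pM => //; rewrite ?exprn_ge0 ?exprn_ile1.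
rewrite mul1r; apply: ler_wpM2l; first exact: ltW.
by rewrite normrZ ger0_norm// ler_piMl.
Qed.

Lemma cont01_dotr (F : 'I_n -> R -> R) (v : 'rV[R]_n) :
  (forall i, cont01 (F i)) ->
  cont01 (fun t => dotr (fun i => F i t) v) /\
  int01 (fun t => dotr (fun i => F i t) v) = dotr (fun i => int01 (F i)) v.
Proof.
move=> cF; have cZ i : cont01 (v 0 i *: F i) by exact: cont01Z.
have E : (fun t => dotr (fun i => F i t) v) = \sum_i (v 0 i *: F i).
  by apply/funext => t; rewrite fct_sumE.
have [c I] := int01_sum (index_enum 'I_n) cZ.
split; rewrite E//.
by rewrite I; apply: eq_bigr => i _; rewrite int01Z.
Qed.

(** The remainder of the integral is the integral of the remainders, which [radial_int_estimate]
    bounds by e |v| uniformly in t. *)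
Lemma radial_int_diff a f x : B x -> Ck 1 B f ->
  differentiable (radial_int a f) x /\
  forall i, 'D_(delta_mx 0 i) (radial_int a f) x =
    radial_int a.+1 (fun z => 'D_(delta_mx 0 i) f z) x.
Proof.
move=> Bx Cf; have C0 := CkS Cf; have cD i : Ck 0 B _ := Cf.2 i.
apply: diff_of_dotr_estimate => e e0.
have Bvx : \forall v \near (0 : 'rV[R]_n), B (v + x).
  have d0 : 0 < r - `|y - x| by move: Bx; rewrite /B -ball_normE/= subr_gt0.
  apply: filterS (nbhs0_lt d0) => v; rewrite /B -ball_normE/= ltrBrDr => vd.
  rewrite opprD addrA addrAC; apply: le_lt_trans vd.
  by rewrite [leRHS]addrC; exact: ler_normB.
apply: filterS2 Bvx (radial_int_estimate a Bx Cf e0) => v Bv h.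
have c1 := radial_int_cont01 (a := a) Bv C0; have c2 := radial_int_cont01 (a := a) Bx C0.
have [c3 I3] := cont01_dotr v (fun i => radial_int_cont01 (a := a.+1) Bx (cD i)).
rewrite /radial_int -I3 -[- int01 _]mulN1r -int01Z// -int01D//; last exact: cont01Z.
rewrite -[- int01 _]mulN1r -int01Z// -int01D; last 2 first.
- by apply: cont01D => //; exact: cont01Z.
- exact: cont01Z.
apply: int01_norm_le.
  by apply: cont01D; [apply: cont01D => //|]; exact: cont01Z.
by move=> t t01; have := h t t01; rewrite !fctE !scaleN1r.
Qed.

Lemma radial_int_smooth a f : smooth_on B f -> smooth_on B (radial_int a f).
Proof.
move=> sf k; elim: k a f sf => [|k IH] a f sf.
  move=> x Bx; apply: differentiable_continuous.
  by have [] := radial_int_diff a Bx (sf 1%N).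
split=> [x Bx|i]; first by have [] := radial_int_diff a Bx (sf 1%N).
have sD : smooth_on B (fun z => 'D_(delta_mx 0 i) f z).
  by move=> j; have [_] := sf j.+1; apply.
apply: Ck_eq (IH a.+1 _ sD); first exact: open_ball_center.
by move=> x Bx; have [_ ->] := radial_int_diff a Bx (sf 1%N).
Qed.

(** The difference f(x) - f(y) is the integral over [0, 1] of the derivative of t |-> f(y + t (x -
    y)), and x - y comes out of the integral: g_i is the mean of D_i f on the segment. At x = y the
    integrand is constant. *)
Lemma hadamard f : smooth_on B f -> exists g : 'I_n -> 'rV[R]_n -> R,
  [/\ forall i, smooth_on B (g i),
      forall x, B x -> f x = f y + dotr (fun i => g i x) (x - y) &
      forall i, g i y = 'D_(delta_mx 0 i) f y].
Proof.
move=> sf; exists (fun i => radial_int 0 (fun z => 'D_(delta_mx 0 i) f z)).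
have sD i : smooth_on B (fun z => 'D_(delta_mx 0 i) f z).
  by move=> j; have [_] := sf j.+1; apply.
split=> [i|x Bx|i]; first exact: radial_int_smooth.
  have c i := radial_int_cont01 (a := 0) Bx (sD i 0%N).
  have [c3 I3] := cont01_dotr (x - y) c.
  have F (t : R) : 0 <= t <= 1 -> is_derive t (1 : R)
      (fun s => f (y + s *: (x - y)))
      (dotr (fun i => t ^+ 0 * 'D_(delta_mx 0 i) f (y + t *: (x - y))) (x - y)).
    move=> t01; have [df _] := sf 1%N.
    have D := is_derive_line (df _ (ball_star Bx t01)).
    by apply: (is_derive_eq D); apply: eq_bigr => i _; rewrite expr0 mul1r.
  by rewrite -I3 (int01_FTC c3 F) scale1r scale0r addr0 subrKC subrKC.
rewrite /radial_int -[RHS]int01_cst; congr int01; apply/funext => t.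
by rewrite expr0 mul1r subrr scaler0 addr0.
Qed.

End Hadamard.

(** * Charts and extension by zero *)

Lemma continuous_dist (R : realType) m (y : 'rV[R]_m) :
  continuous (fun x : 'rV[R]_m => `|x - y|).
Proof.
move=> x; apply: (@cvg_norm _ _ _ (nbhs x)).
by apply: (@cvgB _ _ _ (nbhs x)); [exact: cvg_id|exact: cvg_cst].
Qed.

Section Charts.
Variables (R : realType) (N : manifold R).
Local Notation n := (mfd_dim N).
Implicit Types (c d : chart R n N) (p q : N).

Lemma chart_dom_open c : mfd_atlas c -> open (chart_dom c).
Proof. by move=> Ac; case: (mfd_atlasP N) => /(_ c Ac) []. Qed.

Lemma chart_mapK c p : mfd_atlas c -> chart_dom c p ->
  chart_inv c (chart_map c p) = p.
Proof. by move=> Ac; case: (mfd_atlasP N) => /(_ c Ac) [_ _ /(_ p)]. Qed.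

Lemma chart_map_img c p : chart_dom c p -> chart_img c (chart_map c p).
Proof. by exists p. Qed.

Lemma chart_inv_dom c x : mfd_atlas c -> chart_img c x ->
  chart_dom c (chart_inv c x).
Proof. by move=> Ac [p cp <-]; rewrite chart_mapK. Qed.

Lemma chart_invK c x : mfd_atlas c -> chart_img c x ->
  chart_map c (chart_inv c x) = x.
Proof. by move=> Ac [p cp <-]; rewrite chart_mapK. Qed.

Lemma chart_map_cont c p : mfd_atlas c -> chart_dom c p ->
  {for p, continuous (chart_map c)}.
Proof. by move=> Ac; case: (mfd_atlasP N) => /(_ c Ac) [_ _ _ /(_ p)]. Qed.

Lemma chart_inv_cont c x : mfd_atlas c -> chart_img c x ->
  {for x, continuous (chart_inv c)}.
Proof. by move=> Ac; case: (mfd_atlasP N) => /(_ c Ac) [_ _ _ _ /(_ x)]. Qed.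

Lemma chart_map_preim_open c (V : set 'rV[R]_n) : mfd_atlas c -> open V ->
  open (chart_dom c `&` chart_map c @^-1` V).
Proof.
move=> Ac oV; rewrite openE => p [cp Vp]; apply: filterI.
  by apply: open_nbhs_nbhs; split=> //; exact: chart_dom_open.
by apply: (chart_map_cont Ac cp); exact: open_nbhs_nbhs.
Qed.

Lemma chart_inv_preim_open c (O : set N) : mfd_atlas c -> open O ->
  open (chart_img c `&` chart_inv c @^-1` O).
Proof.
move=> Ac oO; rewrite openE => x [cx Ox]; apply: filterI.
  by apply: open_nbhs_nbhs; split=> //; exact: chart_img_open.
by apply: (chart_inv_cont Ac cx); exact: open_nbhs_nbhs.
Qed.

Lemma chart_cover p : exists2 c, mfd_atlas c & chart_dom c p.
Proof. by case: (mfd_atlasP N). Qed.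

(** Smoothness is required in every chart of the atlas; the transition maps reduce it to one
    convenient chart around each point. *)
Lemma smooth_fun_chart (f : N -> R) :
  (forall p, exists c V, [/\ mfd_atlas c, chart_dom c p, open V,
     V (chart_map c p) & smooth_on V (f \o chart_inv c)]) ->
  smooth_fun (@mfd_atlas R N) f.
Proof.
move=> sf d Ad k; apply: Ck_locally => x dx.
have [c [V [Ac cp oV Vp sV]]] := sf (chart_inv d x).
pose O := chart_dom c `&` chart_map c @^-1` V.
have oO : open O by exact: chart_map_preim_open.
exists (chart_img d `&` chart_inv d @^-1` O).
exists ((f \o chart_inv c) \o (fun x => chart_map c (chart_inv d x))); split.
- exact: chart_inv_preim_open.
- by [].
- by move=> z [dz [cz Vz]] /=; rewrite chart_mapK.
- apply: (@Ck_comp _ _ _ _ _ V) => //.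
  + exact: chart_inv_preim_open.
  + by move=> z [_ []].
  + move=> j; have [_ _ /(_ d c Ad Ac j k)] := mfd_atlasP N.
    apply: Ck_sub => z [dz [cz _]]; exists (chart_inv d z).
      by split=> //; exact: chart_inv_dom.
    exact: chart_invK.
Qed.

Lemma Cinf_smooth (f : Cinf N) c : mfd_atlas c ->
  smooth_on (chart_img c) (f \o chart_inv c).
Proof. by move=> Ac; have /asboolP := cinf_valP f; apply. Qed.

Lemma mkCinf (f : N -> R) : smooth_fun (@mfd_atlas R N) f ->
  exists F : Cinf N, F =1 f.
Proof. by move=> /asboolP sf; exists (MkCinf sf). Qed.

Lemma compact_norm_ball (y : 'rV[R]_n) (r : R) : compact [set x | `|x - y| <= r].
Proof.
apply: bounded_closed_compact.
  exists (r + `|y|); split; first exact: num_real.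
  move=> M ltM x /= xy; rewrite -(subrK y x) (le_trans (ler_normD _ _))//.
  by rewrite (le_trans _ (ltW ltM))// lerD2r.
have -> : [set x : 'rV[R]_n | `|x - y| <= r] =
    (fun x : 'rV[R]_n => `|x - y|) @^-1` [set z | z <= r] by [].
apply: closed_comp; last exact: closed_le.
by move=> x _; exact: continuous_dist.
Qed.

Lemma chart_extension_by_zero c y (r : R) (phi : 'rV[R]_n -> R) : mfd_atlas c ->
  [set x | `|x - y| <= r] `<=` chart_img c ->
  smooth_on (chart_img c) phi -> (forall x, r <= `|x - y| -> phi x = 0) ->
  exists F : Cinf N,
    (forall q, chart_dom c q -> F q = phi (chart_map c q)) /\
    (forall q, ~ chart_dom c q -> F q = 0).
Proof.
move=> Ac rc sphi phi0.
pose f q := if `[< chart_dom c q >] then phi (chart_map c q) else 0.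
have f1 q : chart_dom c q -> f q = phi (chart_map c q).
  by move=> cq; rewrite /f asboolT.
have f2 q : ~ chart_dom c q -> f q = 0 by move=> cq; rewrite /f asboolF.
suff /mkCinf[F FE] : smooth_fun (@mfd_atlas R N) f.
  by exists F; split=> q cq; rewrite FE; [exact: f1|exact: f2].
apply: smooth_fun_chart => p; have [cp|ncp] := pselect (chart_dom c p).
  exists c, (chart_img c); split=> //; first exact: chart_img_open.
    exact: chart_map_img.
  move=> k; apply: Ck_eq (sphi k); first exact: chart_img_open.
  by move=> x cx; rewrite /= f1 ?chart_invK//; exact: chart_inv_dom.
have [d Ad dp] := chart_cover p.
(* The Hausdorff property enters here: K is compact, hence closed in the manifold, so a point
   outside the chart has a neighbourhood off K, where the extension is 0. *)
pose K := chart_inv c @` [set x | `|x - y| <= r].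
have cK : closed K.
  apply: compact_closed; first exact: mfd_hausdorff.
  apply: continuous_compact; last exact: compact_norm_ball.
  apply: continuous_in_subspaceT => x /set_mem xr.
  by apply: chart_inv_cont => //; exact: rc.
have oK : open (~` K) by exact: closed_openC.
exists d, (chart_img d `&` chart_inv d @^-1` (~` K)); split=> //.
- exact: chart_inv_preim_open.
- split; first exact: chart_map_img.
  rewrite /= chart_mapK// => -[x xr xp]; apply: ncp; rewrite -xp.
  by apply: chart_inv_dom => //; exact: rc.
- move=> k; have oV := chart_inv_preim_open Ad oK.
  apply: Ck_eq (Ck_cst k 0 oV) => // x [dx Kx] /=.
  have [cx|ncx] := pselect (chart_dom c (chart_inv d x)); last by rewrite f2.
  rewrite f1// phi0// ltW// ltNge; apply/negP => xr; apply: Kx.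
  by exists (chart_map c (chart_inv d x)) => //; rewrite chart_mapK.
Qed.

(** Since r < s, the open ball of radius s and the set |x - y| > r cover the space; on the second
    one the product is 0, whatever g does there. *)
Lemma Ck_cutoff (m k : nat) (y : 'rV[R]_m) (r s : R) chi g : r < s ->
  smooth_on setT chi -> (forall x, r <= `|x - y| -> chi x = 0) ->
  smooth_on (ball y s) g -> Ck k setT (chi * g).
Proof.
move=> rs schi chi0 sg; apply: Ck_locally => x _.
have [xs|sx] := ltP `|x - y| s.
  exists (ball y s), (chi * g); split=> //; first exact: ball_open.
    by rewrite -ball_normE/= distrC.
  by apply: CkM => //; [exact: ball_open|exact: Ck_sub (schi k)].
exists [set z | r < `|z - y|], (cst 0); split.
- have -> : [set z : 'rV[R]_m | r < `|z - y|] =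
      (fun z : 'rV[R]_m => `|z - y|) @^-1` [set t | r < t] by [].
  apply: open_comp; last exact: open_gt.
  by move=> z _; exact: continuous_dist.
- exact: lt_le_trans sx.
- by move=> z /= rz; rewrite !fctE chi0 ?mul0r// ltW.
- apply: Ck_sub (Ck_cst k 0 openT) => //.
Qed.

Lemma chart_near_inv c p (P : set N) : mfd_atlas c -> chart_dom c p ->
  (\forall q \near p, P q) ->
  \forall x \near chart_map c p, chart_img c x /\ P (chart_inv c x).
Proof.
move=> Ac cp nP; apply: filterI.
  by apply: open_nbhs_nbhs; split; [exact: chart_img_open|exact: chart_map_img].
have h := chart_inv_cont Ac (chart_map_img cp).
by apply: h; rewrite chart_mapK.
Qed.

(* The last clause extends chi * g by zero outside the chart. *)
Lemma chart_cutoff c p (P : set N) : mfd_atlas c -> chart_dom c p ->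
  (\forall q \near p, P q) ->
  exists (r : R) (chi : 'rV[R]_n -> R),
  [/\ 0 < r,
      ball (chart_map c p) r `<=` [set x | chart_img c x /\ P (chart_inv c x)],
      forall x, ~ ball (chart_map c p) r x -> chi x = 0,
      \forall x \near chart_map c p, chi x = 1 &
      forall g, smooth_on (ball (chart_map c p) r) g -> exists F : Cinf N,
        (forall q, chart_dom c q ->
          F q = chi (chart_map c q) * g (chart_map c q)) /\
        (forall q, ~ chart_dom c q -> F q = 0)].
Proof.
move=> Ac cp nP; set y := chart_map c p.
have /nbhs_ballP[r /= r0 rc] := chart_near_inv Ac cp nP.
have r20 : 0 < r / 2 by rewrite divr_gt0.
have r2r : r / 2 < r by rewrite ltr_pdivrMr// ltr_pMr// ltr1n.
have [chi [schi chi0 chi1]] := rV_bump y r20.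
exists r, chi; split=> //.
  move=> x; rewrite -ball_normE/= distrC => /negP; rewrite -leNgt => rx.
  by apply: chi0; rewrite (le_trans (ltW r2r)).
move=> g sg; apply: (@chart_extension_by_zero c y (r / 2) (chi * g)) => //.
- move=> x /= xr; have [] // := rc x; rewrite -ball_normE/= distrC.
  exact: le_lt_trans r2r.
- by move=> k; apply: Ck_sub (Ck_cutoff k r2r schi chi0 sg).
- by move=> x rx; rewrite !fctE chi0// mul0r.
Qed.

(** Derivations act on global functions only, so coordinates are replaced by global functions with
    the same germ at p. *)
Lemma chart_coord_extension c p : mfd_atlas c -> chart_dom c p ->
  exists u : 'I_n -> Cinf N, \forall q \near p,
    chart_dom c q /\ forall i, u i q = chart_map c q 0 i.
Proof.
move=> Ac cp; have [r [chi [r0 rc chi0 chi1 ext]]] :=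
  chart_cutoff (P := setT) Ac cp filterT.
have sx (i : 'I_n) : smooth_on (ball (chart_map c p) r) (fun x : 'rV[R]_n => x 0 i).
  by move=> k; apply: Ck_coord; exact: ball_open.
have [u uE] := choice (fun i => ext _ (sx i)).
exists u; have h : \forall q \near p, chi (chart_map c q) = 1.
  exact: chart_map_cont Ac cp _ chi1.
have h' : \forall q \near p, chart_dom c q.
  by apply: open_nbhs_nbhs; split=> //; exact: chart_dom_open.
apply: filterS2 h h' => q q1 cq.
by split=> // i; rewrite (uE i).1// q1 mul1r.
Qed.

End Charts.

(** * Point derivations *)

Section PointDerivations.
Variables (R : realType) (N : manifold R).
Local Notation n := (mfd_dim N).
Implicit Types (c : chart R n N) (p q : N) (f g : Cinf N).

Definition ptder p (dl : Cinf N -> R) :=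
  (forall (a : R) f g, dl (a *: f + g) = a * dl f + dl g) /\
  (forall f g, dl (f * g) = dl f * g p + f p * dl g).

Lemma cinf_addE f g p : (f + g) p = f p + g p. Proof. by []. Qed.
Lemma cinf_mulE f g p : (f * g) p = f p * g p. Proof. by []. Qed.
Lemma cinf_oppE f p : (- f) p = - f p. Proof. by []. Qed.
Lemma cinf_scaleEp (a : R) f p : (a *: f) p = a * f p. Proof. by []. Qed.

Lemma cinf_eqP f g : f =1 g -> f = g.
Proof. by move=> fg; apply/val_inj/funext. Qed.

Lemma cinf_sumE (I : Type) (r : seq I) (F : I -> Cinf N) p :
  (\sum_(i <- r) F i) p = \sum_(i <- r) F i p.
Proof.
by elim: r => [|i r IH]; rewrite ?big_nil// !big_cons cinf_addE IH.
Qed.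

Lemma ptderD p dl f g : ptder p dl -> dl (f + g) = dl f + dl g.
Proof. by move=> [l _]; rewrite -[f]scale1r l mul1r scale1r. Qed.

Lemma ptder0 p dl : ptder p dl -> dl 0 = 0.
Proof.
by move=> D; apply: (@addrI _ (dl 0)); rewrite -(ptderD _ _ D) !addr0.
Qed.

Lemma ptderZ p dl (a : R) f : ptder p dl -> dl (a *: f) = a * dl f.
Proof. by move=> D; rewrite -[a *: f]addr0 D.1 (ptder0 D) addr0. Qed.

Lemma ptder_sum p dl (I : Type) (r : seq I) (F : I -> Cinf N) : ptder p dl ->
  dl (\sum_(i <- r) F i) = \sum_(i <- r) dl (F i).
Proof.
move=> D; elim: r => [|i r IH]; first by rewrite !big_nil (ptder0 D).
by rewrite !big_cons (ptderD _ _ D) IH.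
Qed.

Lemma ptder_cst p dl a : ptder p dl -> dl (cinf_cst N a) = 0.
Proof.
move=> D; have -> : cinf_cst N a = a *: (1 : Cinf N).
  by apply: cinf_eqP => q; rewrite cinf_scaleEp mulr1.
rewrite (ptderZ _ _ D); have : dl 1 = dl 1 + dl 1.
  by have := D.2 1 1; rewrite !mulr1 mul1r.
by move/eqP; rewrite -subr_eq0 opprD addNKr oppr_eq0 => /eqP ->; rewrite mulr0.
Qed.

Lemma chart_rep_near c p f (phi : 'rV[R]_n -> R) v : mfd_atlas c ->
  chart_dom c p -> (\forall q \near p, chart_dom c q /\ f q = phi (chart_map c q)) ->
  'D_v (f \o chart_inv c) (chart_map c p) = 'D_v phi (chart_map c p).
Proof.
move=> Ac cp h; apply: near_eq_derive.
apply: filterS (chart_near_inv Ac cp h) => x [cx [_ /= ->]].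
by rewrite chart_invK.
Qed.

(* By Hadamard, chi^2 (f - f p) = \sum_i U_i G_i with U_i = chi (x_i - y_i) and
   G_i = chi g_i globally smooth; apply dl to both sides. *)
Lemma ptder_chart c p dl : mfd_atlas c -> chart_dom c p -> ptder p dl ->
  exists a : 'I_n -> R, forall f, dl f =
    \sum_i a i * 'D_(delta_mx 0 i) (f \o chart_inv c) (chart_map c p).
Proof.
move=> Ac cp D; have [r [chi [r0 rc chi0 chi1 ext]]] :=
  chart_cutoff (P := setT) Ac cp filterT.
set y := chart_map c p in rc chi0 chi1 ext *.
have oB : open (ball y r) by exact: ball_open.
have chiy : chi y = 1 by exact: nbhs_singleton chi1.
have [X1 [X1c X10]] := ext (cst 1) (fun k => Ck_cst k _ oB).
have su i : smooth_on (ball y r) ((fun x : 'rV[R]_n => x 0 i) + cst (- y 0 i)).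
  by move=> k; apply: (CkD oB (Ck_coord _ _ oB) (Ck_cst _ _ oB)).
have [U UE] := choice (fun i => ext _ (su i)).
exists (fun i => dl (U i)) => f.
have sf : smooth_on (ball y r) (f \o chart_inv c).
  by move=> k; apply: Ck_sub (Cinf_smooth f Ac k) => x /rc[].
have [g [sg fg gy]] := hadamard sf.
have [G GE] := choice (fun i => ext _ (sg i)).
have E : X1 * X1 * (f - cinf_cst N (f p)) = \sum_i U i * G i.
  apply: cinf_eqP => q; rewrite cinf_sumE !cinf_mulE cinf_addE cinf_oppE.
  have -> : cinf_cst N (f p) q = f p by [].
  have [cq|ncq] := pselect (chart_dom c q); last first.
    rewrite X10// !mul0r big1// => i _.
    by rewrite cinf_mulE (UE i).2// mul0r.
  rewrite X1c// /cst mulr1.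
  under eq_bigr do rewrite cinf_mulE (UE _).1// (GE _).1//.
  have [Bq|nBq] := pselect (ball y r (chart_map c q)); last first.
    by rewrite chi0// !mul0r big1// => i _; rewrite !mul0r.
  have := fg _ Bq; rewrite /= !chart_mapK// => ->.
  rewrite addrC addKr /dotr mulr_sumr; apply: eq_bigr => i _.
  by rewrite !mxE !fctE; ring.
have X1p : X1 p = 1 by rewrite X1c// chiy mulr1.
have df : dl (f - cinf_cst N (f p)) = dl f.
  rewrite (ptderD _ _ D) -scaleN1r (ptderZ _ _ D) (ptder_cst _ D) mulr0.
  by rewrite addr0.
have f0 : (f - cinf_cst N (f p)) p = 0 by exact: subrr.
have := congr1 dl E; rewrite D.2 (ptder_sum _ _ D) df f0 cinf_mulE X1p.
rewrite !mul1r mulr0 add0r => ->.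
apply: eq_bigr => i _; rewrite D.2 (UE i).1// (GE i).1//.
by rewrite -/y chiy !mul1r !fctE subrr mul0r addr0 gy.
Qed.

(** Testing the expansion of [ptder_chart] on the u_i identifies its coefficients. As u depends
    neither on dl nor on f, the formula applies to whole families of derivations and functions at
    once. *)
Lemma ptder_coord c p (u : 'I_n -> Cinf N) : mfd_atlas c ->
  (\forall q \near p, chart_dom c q /\ forall i, u i q = chart_map c q 0 i) ->
  forall dl f, ptder p dl ->
  dl f = \sum_i dl (u i) *
    'D_(delta_mx 0 i) (f \o chart_inv c) (chart_map c p).
Proof.
move=> Ac hu dl f D; have [cp _] := nbhs_singleton hu.
have [a aE] := ptder_chart Ac cp D.
suff ua i : dl (u i) = a i by rewrite aE; apply: eq_bigr => i _; rewrite ua.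
rewrite aE (bigD1 i)//= big1 ?addr0 => [|j ji].
  rewrite (chart_rep_near (phi := fun x => x 0 i))//.
    by rewrite derive_coord mxE !eqxx mulr1.
  by apply: filterS hu => q [cq ->].
rewrite (chart_rep_near (phi := fun x => x 0 i))//.
  by rewrite derive_coord mxE eq_sym (negbTE ji) mulr0.
by apply: filterS hu => q [cq ->].
Qed.

Lemma vfield_ptder (X : vfield N) p : ptder p (fun f => X f p).
Proof. by split=> [a f g|f g]; rewrite ?vf_linear ?vfM. Qed.

End PointDerivations.

(** * Product manifolds *)

Section BlockProjections.
Variables (R : realType) (m n : nat).

Lemma lsubmx_preim_open (V : set 'rV[R]_m) : open V ->
  open ((@lsubmx R 1 m n) @^-1` V).
Proof. by move=> oV; apply: open_comp => // x _; exact: continuous_lsubmx. Qed.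

Lemma rsubmx_preim_open (V : set 'rV[R]_n) : open V ->
  open ((@rsubmx R 1 m n) @^-1` V).
Proof. by move=> oV; apply: open_comp => // x _; exact: continuous_rsubmx. Qed.

Lemma Ck_lsubmx k (V : set 'rV[R]_m) f : open V -> Ck k V f ->
  Ck k ((@lsubmx R 1 m n) @^-1` V) (f \o lsubmx).
Proof.
move=> oV cf; have oU := lsubmx_preim_open oV.
apply: (Ck_comp oU oV) cf => // j.
have -> : (fun x : 'rV[R]_(m + n) => lsubmx x 0 j) = fun x => x 0 (lshift n j).
  by apply/funext => x; rewrite mxE.
exact: Ck_coord.
Qed.

Lemma Ck_rsubmx k (V : set 'rV[R]_n) f : open V -> Ck k V f ->
  Ck k ((@rsubmx R 1 m n) @^-1` V) (f \o rsubmx).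
Proof.
move=> oV cf; have oU := rsubmx_preim_open oV.
apply: (Ck_comp oU oV) cf => // j.
have -> : (fun x : 'rV[R]_(m + n) => rsubmx x 0 j) = fun x => x 0 (rshift m j).
  by apply/funext => x; rewrite mxE.
exact: Ck_coord.
Qed.

(** The predicate bears on the coordinate as a function of both blocks, so that continuity or class
    C^k of a map into a product can be split where the two blocks occur under a binder. *)
Lemma row_mx_coord_ind (P : ('rV[R]_m -> 'rV[R]_n -> R) -> Prop) :
  (forall j, P (fun a _ => a 0 j)) -> (forall j, P (fun _ b => b 0 j)) ->
  forall j, P (fun a b => row_mx a b 0 j).
Proof.
move=> Pl Pr j; case: (split_ordP j) => i ->.
  have -> : (fun a b => row_mx a b 0 (lshift n i)) =
    (fun (a : 'rV[R]_m) (b : 'rV[R]_n) => a 0 i).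
    by apply/funext => a; apply/funext => b; rewrite row_mxEl.
  exact: Pl.
have -> : (fun a b => row_mx a b 0 (rshift m i)) =
  (fun (a : 'rV[R]_m) (b : 'rV[R]_n) => b 0 i).
  by apply/funext => a; apply/funext => b; rewrite row_mxEr.
exact: Pr.
Qed.

End BlockProjections.

Lemma open_setX (T U : topologicalType) (A : set T) (B : set U) :
  open A -> open B -> open (A `*` B).
Proof.
move=> oA oB; rewrite openE => -[a b] [/= Aa Bb]; exists (A, B) => //=.
by split; exact: open_nbhs_nbhs.
Qed.

Section ProductManifold.
Variables (R : realType) (N M : manifold R).
Local Notation AN := (@mfd_atlas R N).
Local Notation AM := (@mfd_atlas R M).

Lemma prod_hausdorff : hausdorff_space (N * M)%type.
Proof.
move=> [a b] [a' b'] h.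
have ha : a = a'.
  apply: (@mfd_hausdorff R N) => A B nA nB.
  have [] := h (A `*` setT) (B `*` setT).
  - by exists (A, setT) => //; split=> //; exact: filterT.
  - by exists (B, setT) => //; split=> //; exact: filterT.
  by move=> [x y] [[/= Ax _] [/= Bx _]]; exists x.
have hb : b = b'.
  apply: (@mfd_hausdorff R M) => A B nA nB.
  have [] := h (setT `*` A) (setT `*` B).
  - by exists (setT, A) => //; split=> //; exact: filterT.
  - by exists (setT, B) => //; split=> //; exact: filterT.
  by move=> [x y] [[/= _ Ay] [/= _ By]]; exists y.
by rewrite ha hb.
Qed.

Lemma prod_second_countable : @second_countable (N * M)%type.
Proof.
have [B cB [oB bB]] := @mfd_second_countable R N.
have [C cC [oC bC]] := @mfd_second_countable R M.
exists ((fun UV : set N * set M => UV.1 `*` UV.2) @` (B `*` C)).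
  exact: sub_countable (card_image_le _ _) (countableX cB cC).
split=> [_ [[U V] [/= BU CV] <-]|[a b] W [[P Q] /= [aP bQ] PQW]].
  by apply: open_setX; [exact: oB|exact: oC].
have [U [BU Ua] UP] := bB a P aP; have [V [CV Vb] VQ] := bC b Q bQ.
exists (U `*` V); first by split=> //; exists (U, V).
by move=> [x y] [/= Ux Vy]; apply: PQW; split; [exact: UP|exact: VQ].
Qed.

Lemma prod_chart_img c d : chart_img (prod_chart c d) =
  (@lsubmx R 1 (mfd_dim N) (mfd_dim M)) @^-1` (@chart_img R _ N c) `&`
  (@rsubmx R 1 (mfd_dim N) (mfd_dim M)) @^-1` (@chart_img R _ M d).
Proof.
apply/seteqP; split=> [_ [[p q] [/= cp dq] <-]|x [/= [p cp px] [q dq qx]]].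
  by split; rewrite /= ?row_mxKl ?row_mxKr; [exists p|exists q].
by exists (p, q) => //=; rewrite px qx hsubmxK.
Qed.

Lemma prod_is_chart c d : AN c -> AM d ->
  is_chart (prod_chart c d : chart R _ (N * M)%type).
Proof.
move=> Ac Ad; split.
- by apply: open_setX; exact: chart_dom_open.
- rewrite prod_chart_img; apply: openI.
    by apply: lsubmx_preim_open; exact: chart_img_open.
  by apply: rsubmx_preim_open; exact: chart_img_open.
- by move=> [p q] [/= cp dq]; rewrite row_mxKl row_mxKr !chart_mapK.
- move=> [p q] [/= cp dq].
  have c1 : {for (p, q), continuous (fun z : N * M => chart_map c z.1)}.
    apply: (@continuous_comp (N * M)%type N _ fst (chart_map c)).
      exact: cvg_fst.
    exact: chart_map_cont.
  have c2 : {for (p, q), continuous (fun z : N * M => chart_map d z.2)}.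
    apply: (@continuous_comp (N * M)%type M _ snd (chart_map d)).
      exact: cvg_snd.
    exact: chart_map_cont.
  apply: rV_continuous_at => j /=.
  apply: (row_mx_coord_ind (P := fun F => {for (p, q),
     continuous (fun z : N * M => F (chart_map c z.1) (chart_map d z.2))})) => i.
    exact: (continuous_comp c1 (@coord_continuous R 1 _ 0 i _)).
  exact: (continuous_comp c2 (@coord_continuous R 1 _ 0 i _)).
- move=> x; rewrite prod_chart_img => -[/= cx dx].
  have c1 : {for x, continuous (fun x : 'rV[R]_(mfd_dim N + mfd_dim M) =>
      chart_inv c (lsubmx x))}.
    apply: (@continuous_comp _ _ N lsubmx (chart_inv c)).
      exact: continuous_lsubmx.
    exact: chart_inv_cont.
  have c2 : {for x, continuous (fun x : 'rV[R]_(mfd_dim N + mfd_dim M) =>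
      chart_inv d (rsubmx x))}.
    apply: (@continuous_comp _ _ M rsubmx (chart_inv d)).
      exact: continuous_rsubmx.
    exact: chart_inv_cont.
  exact: cvg_pair c1 c2.
Qed.

Lemma transition_open (N' : manifold R) (c c' : chart R (mfd_dim N') N') :
  mfd_atlas c -> mfd_atlas c' ->
  open (chart_map c @` (chart_dom c `&` chart_dom c')).
Proof.
move=> Ac Ac'.
have -> : chart_map c @` (chart_dom c `&` chart_dom c') =
    chart_img c `&` chart_inv c @^-1` chart_dom c'.
  apply/seteqP; split=> [_ [p [cp c'p] <-]|x [cx c'x]].
    by split; [exists p|rewrite /= chart_mapK].
  exists (chart_inv c x); last exact: chart_invK.
  by split=> //; exact: chart_inv_dom.
by apply: chart_inv_preim_open => //; exact: chart_dom_open.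
Qed.

Lemma prod_is_atlas : is_atlas (prod_atlas AN AM).
Proof.
split.
- by move=> _ [c [d [Ac Ad ->]]]; exact: prod_is_chart.
- move=> [p q]; have [c Ac cp] := chart_cover p; have [d Ad dq] := chart_cover q.
  by exists (prod_chart c d) => //; exists c, d.
- move=> _ _ [c [d [Ac Ad ->]]] [c' [d' [Ac' Ad' ->]]] j k /=.
  have [_ _ tN] := mfd_atlasP N; have [_ _ tM] := mfd_atlasP M.
  apply: (row_mx_coord_ind (P := fun F => Ck k _ (fun x : 'rV[R]_(_ + _) =>
    F (chart_map c' (chart_inv c (lsubmx x)))
      (chart_map d' (chart_inv d (rsubmx x)))))) => i.
    have h := Ck_lsubmx (mfd_dim M) (transition_open Ac Ac')
      (tN _ _ Ac Ac' i k).
    apply: (Ck_sub _ h).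
    move=> _ [[p q] [[/= cp dq] [/= c'p d'q]] <-] /=.
    by rewrite row_mxKl; exists p.
  have h := Ck_rsubmx (mfd_dim N) (transition_open Ad Ad')
    (tM _ _ Ad Ad' i k).
  apply: (Ck_sub _ h).
  move=> _ [[p q] [[/= cp dq] [/= c'p d'q]] <-] /=.
  by rewrite row_mxKr; exists q.
Qed.

Definition prod_manifold : manifold R :=
  Manifold prod_hausdorff prod_second_countable prod_is_atlas.

End ProductManifold.

(** * Smooth maps *)

Section SmoothMaps.
Variable R : realType.

(** Smoothness is tested on pulled-back functions, which is all that derivations see and makes
    composition immediate. Continuity is kept as a component because it brings nearby points into
    the domain of a chart. *)
Definition pull_smooth (N M : manifold R) (F : N -> M) :=
  continuous F /\ forall f : Cinf M, f \o F \in @smooth_pred R N.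

Definition pullback (N M : manifold R) (F : N -> M) (sF : pull_smooth F)
  (f : Cinf M) : Cinf N := MkCinf (sF.2 f).

Lemma pull_smooth_cst (N M : manifold R) (b : M) : pull_smooth (fun _ : N => b).
Proof. by split=> [x|f]; [exact: cvg_cst|exact: smooth_cst]. Qed.

Lemma pull_smooth_id (N : manifold R) : pull_smooth (@id N).
Proof. by split=> [x|f]; [exact: cvg_id|exact: cinf_valP]. Qed.

Lemma pull_smooth_comp (N M P : manifold R) (F : N -> M) (H : M -> P) :
  pull_smooth F -> pull_smooth H -> pull_smooth (H \o F).
Proof.
move=> sF sH; split=> [x|f]; last exact: sF.2 (pullback sH f).
by apply: continuous_comp; [exact: sF.1|exact: sH.1].
Qed.

Lemma smooth_map_pull (N M : manifold R) (F : N -> M) :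
  smooth_map (@mfd_atlas R N) (@mfd_atlas R M) F -> pull_smooth F.
Proof.
move=> [cF sF]; split=> // f; apply/asboolP/smooth_fun_chart => p.
have [c Ac cp] := chart_cover p; have [d Ad dq] := chart_cover (F p).
pose O := F @^-1` chart_dom d.
have oO : open O.
  by apply: open_comp => [x _|]; [exact: cF|exact: chart_dom_open].
exists c, (chart_img c `&` chart_inv c @^-1` O); split=> //.
- exact: chart_inv_preim_open.
- by split; [exact: chart_map_img|rewrite /= chart_mapK].
- move=> k; have oV := chart_inv_preim_open Ac oO.
  apply: (@Ck_eq _ _ _ _ ((f \o chart_inv d) \o
      (fun x => chart_map d (F (chart_inv c x))))) => //.
    by move=> x [cx Ox] /=; rewrite chart_mapK.
  apply: (Ck_comp oV (chart_img_open Ad)); last exact: Cinf_smooth.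
    by move=> x [_]; exact: chart_map_img.
  move=> j; apply: Ck_sub (sF c d Ac Ad j k) => x [cx Ox].
  exists (chart_inv c x); last exact: chart_invK.
  by split=> //; exact: chart_inv_dom.
Qed.

Lemma pull_smooth_fst (N M : manifold R) :
  pull_smooth (fst : prod_manifold N M -> N).
Proof.
split=> [x|f]; first exact: cvg_fst.
apply/asboolP => _ [c [d [Ac Ad ->]]] k.
have h := Ck_lsubmx (mfd_dim M) (chart_img_open Ac) (Cinf_smooth f Ac k).
by apply: Ck_sub h; rewrite prod_chart_img => x [].
Qed.

Lemma pull_smooth_snd (N M : manifold R) :
  pull_smooth (snd : prod_manifold N M -> M).
Proof.
split=> [x|f]; first exact: cvg_snd.
apply/asboolP => _ [c [d [Ac Ad ->]]] k.
have h := Ck_rsubmx (mfd_dim N) (chart_img_open Ad) (Cinf_smooth f Ad k).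
by apply: Ck_sub h; rewrite prod_chart_img => x [].
Qed.

(** A function on the product is not built from functions on the factors, so charts are needed: near
    p, f o (s, t) is f in a product chart composed with the global functions u_i o s and v_i o t,
    which are smooth by hypothesis. *)
Lemma pull_smooth_pair (P N M : manifold R) (s : P -> N) (t : P -> M) :
  pull_smooth s -> pull_smooth t ->
  pull_smooth ((fun z => (s z, t z)) : P -> prod_manifold N M).
Proof.
move=> ss st; split=> [x|f]; first by apply: cvg_pair; [exact: ss.1|exact: st.1].
apply/asboolP/smooth_fun_chart => p.
have [e Ae ep] := chart_cover p.
have [c Ac cp] := chart_cover (s p); have [d Ad dp] := chart_cover (t p).
have [u uE] := chart_coord_extension Ac cp.
have [v vE] := chart_coord_extension Ad dp.
have su : \forall q \near p, chart_dom c (s q) /\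
    forall i, u i (s q) = chart_map c (s q) 0 i by exact: ss.1 uE.
have tv : \forall q \near p, chart_dom d (t q) /\
    forall i, v i (t q) = chart_map d (t q) 0 i by exact: st.1 vE.
pose W : set 'rV[R]_(mfd_dim P) := [set x | chart_img e x /\
  ((chart_dom c (s (chart_inv e x)) /\ forall i,
     u i (s (chart_inv e x)) = chart_map c (s (chart_inv e x)) 0 i) /\
   (chart_dom d (t (chart_inv e x)) /\ forall i,
     v i (t (chart_inv e x)) = chart_map d (t (chart_inv e x)) 0 i))].
have nW : nbhs (chart_map e p) W by exact: chart_near_inv Ae ep (filterI su tv).
pose u' := pullback ss \o u; pose v' := pullback st \o v.
exists e, W^°; split=> //; first exact: open_interior.
move=> k; have oV : open W^° by exact: open_interior.
have Ap : @mfd_atlas R (prod_manifold N M) (prod_chart c d).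
  by exists c, d.
apply: (@Ck_eq _ _ _ _ ((f \o chart_inv (prod_chart c d)) \o
   (fun x => row_mx (\row_i (u' i \o chart_inv e) x)
                    (\row_i (v' i \o chart_inv e) x)))) => //.
  move=> x /interior_subset[ex [[cx ux] [dx vx]]] /=.
  rewrite row_mxKl row_mxKr.
  have -> : \row_i u i (s (chart_inv e x)) = chart_map c (s (chart_inv e x)).
    by apply/rowP => i; rewrite mxE ux.
  have -> : \row_i v i (t (chart_inv e x)) = chart_map d (t (chart_inv e x)).
    by apply/rowP => i; rewrite mxE vx.
  by rewrite !chart_mapK.
apply: (Ck_comp oV (chart_img_open Ap)); last exact: (Cinf_smooth f Ap).
  move=> x /interior_subset[ex [[cx ux] [dx vx]]].
  rewrite prod_chart_img; split; rewrite /= ?row_mxKl ?row_mxKr.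
    exists (s (chart_inv e x)) => //.
    by apply/rowP => i; rewrite mxE /= ux.
  exists (t (chart_inv e x)) => //.
  by apply/rowP => i; rewrite mxE /= vx.
apply: (row_mx_coord_ind (P := fun F => Ck k W^° (fun x =>
  F (\row_i (u' i \o chart_inv e) x) (\row_i (v' i \o chart_inv e) x)))) => i.
  have -> : (fun x => (\row_i (u' i \o chart_inv e) x) 0 i) = u' i \o chart_inv e.
    by apply/funext => x; rewrite mxE.
  by apply: Ck_sub (Cinf_smooth (u' i) Ae k) => x /interior_subset[].
have -> : (fun x => (\row_i (v' i \o chart_inv e) x) 0 i) = v' i \o chart_inv e.
  by apply/funext => x; rewrite mxE.
by apply: Ck_sub (Cinf_smooth (v' i) Ae k) => x /interior_subset[].
Qed.

Definition slice_r (N M : manifold R) (a : N) : Cinf (prod_manifold N M) -> Cinf M :=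
  pullback (pull_smooth_pair (pull_smooth_cst M a) (pull_smooth_id M)).

Definition swap_cinf (N M : manifold R) :
    Cinf (prod_manifold N M) -> Cinf (prod_manifold M N) :=
  pullback (pull_smooth_pair (@pull_smooth_snd M N) (@pull_smooth_fst M N)).

Lemma slice_rE (N M : manifold R) (a : N) (f : Cinf (prod_manifold N M)) b :
  slice_r a f b = f (a, b).
Proof. by []. Qed.

(** The coordinates of a product chart extend to the functions w, each pulled back from one factor,
    so all coefficients in [ptder_coord] are 0. *)
Lemma ptder_prod_eq0 (N M : manifold R) (z : prod_manifold N M) dl :
  ptder z dl ->
  (forall f, dl (pullback (@pull_smooth_fst N M) f) = 0) ->
  (forall f, dl (pullback (@pull_smooth_snd N M) f) = 0) ->
  forall f, dl f = 0.
Proof.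
case: z => a b D dl1 dl2 f.
have [c Ac ca] := chart_cover a; have [d Ad db] := chart_cover b.
have [u uE] := chart_coord_extension Ac ca.
have [v vE] := chart_coord_extension Ad db.
have Ap : @mfd_atlas R (prod_manifold N M) (prod_chart c d).
  by exists c, d.
pose w (i : 'I_(mfd_dim N + mfd_dim M)) : Cinf (prod_manifold N M) :=
  match fintype.split i with
  | inl j => pullback (@pull_smooth_fst N M) (u j)
  | inr j => pullback (@pull_smooth_snd N M) (v j)
  end.
have wE : \forall q \near ((a, b) : prod_manifold N M),
    chart_dom (prod_chart c d) q /\
    forall i, w i q = chart_map (prod_chart c d) q 0 i.
  exists ([set x | chart_dom c x /\ forall i, u i x = chart_map c x 0 i],
     [set x | chart_dom d x /\ forall i, v i x = chart_map d x 0 i]) => //=.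
  move=> [x y] [/= [cx ux] [dy vy]]; split=> // i; rewrite mxE /w.
  by case: fintype.split => j /=.
rewrite (ptder_coord Ap wE f D) big1// => i _.
by rewrite /w; case: fintype.split => j; rewrite ?dl1 ?dl2 mul0r.
Qed.

(* The difference of the two sides is a point derivation in Psi that kills the
   functions pulled back from the factors. *)
Lemma ptder_diag (P N M : manifold R) (p : P) dl (s : P -> N) (t : P -> M)
    (ss : pull_smooth s) (st : pull_smooth t)
    (Psi : Cinf (prod_manifold N M)) (F F1 F2 : Cinf P) : ptder p dl ->
  (forall z, F z = Psi (s z, t z)) -> (forall z, F1 z = Psi (s z, t p)) ->
  (forall z, F2 z = Psi (s p, t z)) ->
  dl F = dl F1 + dl F2.
Proof.
move=> D FE F1E F2E.
pose A := pullback (pull_smooth_pair ss st).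
pose B := pullback (pull_smooth_pair ss (pull_smooth_cst P (t p))).
pose C := pullback (pull_smooth_pair (pull_smooth_cst P (s p)) st).
have -> : F = A Psi by apply: cinf_eqP => z; rewrite FE.
have -> : F1 = B Psi by apply: cinf_eqP => z; rewrite F1E.
have -> : F2 = C Psi by apply: cinf_eqP => z; rewrite F2E.
pose T (f : Cinf (prod_manifold N M)) := dl (A f) - dl (B f) - dl (C f).
suff : T Psi = 0 by rewrite /T => /eqP; rewrite -addrA -opprD subr_eq0 => /eqP.
apply: (@ptder_prod_eq0 _ _ (s p, t p)).
- have lin (H : P -> prod_manifold N M) (sH : pull_smooth H) (a : R)
      (f g : Cinf (prod_manifold N M)) :
      dl (pullback sH (a *: f + g)) =
      a * dl (pullback sH f) + dl (pullback sH g).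
    have -> : pullback sH (a *: f + g) = a *: pullback sH f + pullback sH g.
      exact: cinf_eqP.
    exact: D.1.
  have mul (H : P -> prod_manifold N M) (sH : pull_smooth H)
      (f g : Cinf (prod_manifold N M)) :
      H p = (s p, t p) -> dl (pullback sH (f * g)) =
      dl (pullback sH f) * g (s p, t p) + f (s p, t p) * dl (pullback sH g).
    have -> : pullback sH (f * g) = pullback sH f * pullback sH g.
      exact: cinf_eqP.
    by move=> <-; exact: D.2.
  split=> [a f g|f g]; rewrite /T; first by rewrite !lin; ring.
  by rewrite !mul//; ring.
- move=> f; rewrite /T.
  have -> : B (pullback (@pull_smooth_fst N M) f) = A (pullback (@pull_smooth_fst N M) f).
    exact: cinf_eqP.
  have -> : C (pullback (@pull_smooth_fst N M) f) = cinf_cst P (f (s p)).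
    exact: cinf_eqP.
  by rewrite (ptder_cst _ D) subrr subr0.
- move=> f; rewrite /T.
  have -> : C (pullback (@pull_smooth_snd N M) f) = A (pullback (@pull_smooth_snd N M) f).
    exact: cinf_eqP.
  have -> : B (pullback (@pull_smooth_snd N M) f) = cinf_cst P (f (t p)).
    exact: cinf_eqP.
  by rewrite (ptder_cst _ D) subr0 subrr.
Qed.

End SmoothMaps.

(** * Lifting vector fields to a product *)

Section LiftedFields.
Variables (R : realType) (N M : manifold R).
Local Notation NM := (prod_manifold N M).

Lemma derive_row_mx_r m n (a : 'rV[R]_m) (y v : 'rV[R]_n)
    (phi : 'rV[R]_(m + n) -> R) :
  'D_v (fun y => phi (row_mx a y)) y = 'D_(row_mx 0 v) phi (row_mx a y).
Proof.
rewrite /derive; set D := (fun _ : R => _); set D' := (fun _ : R => _).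
suff -> : D = D' by [].
by apply/funext => h; rewrite /D /D' /= scale_row_mx add_row_mx scaler0 add0r.
Qed.

(** X is applied to a function that varies with the parameter a. By [ptder_coord] the value at (a,
    q) is the sum of X(v_i)(q) times the i-th partial derivative of f in the second block, and
    X(v_i) does not involve a. *)
Lemma lift_r_smooth (X : vfield M) (f : Cinf NM) :
  (fun z : NM => X (slice_r z.1 f) z.2) \in @smooth_pred R NM.
Proof.
apply/asboolP/smooth_fun_chart => -[a0 b0].
have [c Ac ca] := chart_cover a0; have [d Ad db] := chart_cover b0.
have [v vE] := chart_coord_extension Ad db.
(* The interior is taken because [ptder_coord] needs the v_i to be coordinates near every point of
   O, not only at it. *)
pose O := [set q | chart_dom d q /\ forall i, v i q = chart_map d q 0 i]^°.
have Ob : O b0 by [].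
have oO : open O by exact: open_interior.
have Ap : @mfd_atlas R NM (prod_chart c d) by exists c, d.
pose V2 := chart_img d `&` chart_inv d @^-1` O.
have oV2 : open V2 by exact: chart_inv_preim_open.
pose V := chart_img (prod_chart c d) `&`
  (@rsubmx R 1 (mfd_dim N) (mfd_dim M)) @^-1` V2.
have oV : open V.
  by apply: openI; [exact: (chart_img_open Ap)|exact: rsubmx_preim_open].
exists (prod_chart c d), V; split=> //.
  split; first by exists (a0, b0).
  by rewrite /= row_mxKr; split; [exact: chart_map_img|rewrite /= chart_mapK].
move=> k; pose fh := f \o chart_inv (prod_chart c d).
apply: (@Ck_eq _ _ _ _ (\sum_i
    (((X (v i) \o chart_inv d) \o (@rsubmx R 1 (mfd_dim N) (mfd_dim M))) *
     (fun x => 'D_(delta_mx 0 (rshift (mfd_dim N) i)) fh x)))) => //.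
  move=> x [xV [dx Ox]]; move: (xV); rewrite prod_chart_img => -[cx _].
  rewrite fct_sumE /=; set a := chart_inv c _; set b := chart_inv d _.
  have bE : \forall q \near b,
      chart_dom d q /\ forall i, v i q = chart_map d q 0 i.
    exact: Ox.
  have sE : slice_r a f \o chart_inv d = fun y => fh (row_mx (chart_map c a) y).
    apply/funext => y; rewrite /fh /= row_mxKl row_mxKr chart_mapK//.
    exact: chart_inv_dom.
  rewrite (ptder_coord Ad bE (slice_r a f) (vfield_ptder X b)) sE.
  apply: eq_bigr => i _; rewrite !fctE /=; congr (_ * _).
  rewrite derive_row_mx_r !chart_invK// hsubmxK; congr ('D_ _ _ _).
  by apply/rowP => j; rewrite !mxE; case: split_ordP => j' ->;
    rewrite ?mxE !eqxx/= ?(inj_eq (@rshift_inj _ _)) ?eq_lrshift.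
have cD i : Ck k (chart_img (prod_chart c d))
    (fun x => 'D_(delta_mx 0 (rshift (mfd_dim N) i)) fh x).
  by have [_] := Cinf_smooth f Ap k.+1; apply.
apply: Ck_sum => // i _; apply: CkM => //.
  have h := Ck_rsubmx (mfd_dim N) (chart_img_open Ad) (Cinf_smooth (X (v i)) Ad k).
  by apply: Ck_sub h => x [_ []].
by apply: Ck_sub (cD i) => x [].
Qed.

Definition lift_r_fun (X : vfield M) (f : Cinf NM) : Cinf NM :=
  MkCinf (lift_r_smooth X f).

Lemma lift_r_subproof X : lift_r_fun X \in @derivation_pred R NM.
Proof.
apply/asboolP; split=> [a f g|f g]; apply: cinf_eqP => -[p q].
  change (X (slice_r p (a *: f + g)) q =
    (a *: lift_r_fun X f + lift_r_fun X g) (p, q)).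
  have -> : slice_r p (a *: f + g) = a *: slice_r p f + slice_r p g.
    exact: cinf_eqP.
  by rewrite vf_linear.
change (X (slice_r p (f * g)) q =
  (lift_r_fun X f * g + f * lift_r_fun X g) (p, q)).
have -> : slice_r p (f * g) = slice_r p f * slice_r p g by exact: cinf_eqP.
by rewrite vfM.
Qed.

Definition lift_r (X : vfield M) : vfield NM := MkVfield (lift_r_subproof X).

Lemma lift_rE X f z : lift_r X f z = X (slice_r z.1 f) z.2.
Proof. by []. Qed.

End LiftedFields.

Section LiftedFieldsLeft.
Variables (R : realType) (N M : manifold R).
Local Notation NM := (prod_manifold N M).

Lemma lift_l_subproof (X : vfield N) :
  (fun f : Cinf NM => swap_cinf (lift_r M X (swap_cinf f)))
    \in @derivation_pred R NM.
Proof.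
have sl (a : R) (f g : Cinf NM) :
    swap_cinf (a *: f + g) = a *: swap_cinf f + swap_cinf g.
  exact: cinf_eqP.
have sm (f g : Cinf NM) : swap_cinf (f * g) = swap_cinf f * swap_cinf g.
  exact: cinf_eqP.
apply/asboolP; split=> [a f g|f g]; rewrite ?sl ?sm ?vf_linear ?vfM;
  by apply: cinf_eqP => -[].
Qed.

Definition lift_l (X : vfield N) : vfield NM := MkVfield (lift_l_subproof X).

Definition slice_l (b : M) (f : Cinf NM) : Cinf N := slice_r b (swap_cinf f).

Lemma lift_lE X f z : lift_l X f z = X (slice_l z.2 f) z.1.
Proof. by []. Qed.

Lemma vf_cst (X : vfield N) a : X (cinf_cst N a) = 0.
Proof. by apply: cinf_eqP => p; exact: (ptder_cst _ (vfield_ptder X p)). Qed.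

End LiftedFieldsLeft.

(* The bracket of the two lifts kills the functions pulled back from the
   factors; this replaces the symmetry of second derivatives. *)
Lemma lift_comm (R : realType) (N M : manifold R) (X : vfield N) (Y : vfield M)
    (f : Cinf (prod_manifold N M)) :
  lift_l M X (lift_r N Y f) = lift_r N Y (lift_l M X f).
Proof.
apply: cinf_eqP => z; apply/eqP; rewrite -subr_eq0; apply/eqP.
pose B := vfbracket (lift_l M X) (lift_r N Y).
apply: (ptder_prod_eq0 (vfield_ptder B z)) => g.
- have e1 : lift_r N Y (pullback (pull_smooth_fst N M) g) = 0.
    apply: cinf_eqP => -[a b]; rewrite lift_rE.
    have -> : slice_r a (pullback (pull_smooth_fst N M) g) = cinf_cst M (g a).
      exact: cinf_eqP.
    by rewrite vf_cst.
  have e2 : lift_l M X (pullback (pull_smooth_fst N M) g) =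
      pullback (pull_smooth_fst N M) (X g).
    apply: cinf_eqP => -[a b]; rewrite lift_lE /=; congr (X _ a).
    exact: cinf_eqP.
  have e3 : lift_r N Y (pullback (pull_smooth_fst N M) (X g)) = 0.
    apply: cinf_eqP => -[a b]; rewrite lift_rE.
    have -> : slice_r a (pullback (pull_smooth_fst N M) (X g)) = cinf_cst M (X g a).
      exact: cinf_eqP.
    by rewrite vf_cst.
  suff BE : B (pullback (pull_smooth_fst N M) g) = 0 by rewrite BE.
  rewrite -[B _]/(lift_l M X (lift_r N Y (pullback (pull_smooth_fst N M) g)) -
    lift_r N Y (lift_l M X (pullback (pull_smooth_fst N M) g))).
  by rewrite e1 e2 e3 vf0 subrr.
- have e1 : lift_l M X (pullback (pull_smooth_snd N M) g) = 0.
    apply: cinf_eqP => -[a b]; rewrite lift_lE.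
    have -> : slice_l b (pullback (pull_smooth_snd N M) g) = cinf_cst N (g b).
      exact: cinf_eqP.
    by rewrite vf_cst.
  have e2 : lift_r N Y (pullback (pull_smooth_snd N M) g) =
      pullback (pull_smooth_snd N M) (Y g).
    apply: cinf_eqP => -[a b]; rewrite lift_rE /=; congr (Y _ b).
    exact: cinf_eqP.
  have e3 : lift_l M X (pullback (pull_smooth_snd N M) (Y g)) = 0.
    apply: cinf_eqP => -[a b]; rewrite lift_lE.
    have -> : slice_l b (pullback (pull_smooth_snd N M) (Y g)) = cinf_cst N (Y g b).
      exact: cinf_eqP.
    by rewrite vf_cst.
  suff BE : B (pullback (pull_smooth_snd N M) g) = 0 by rewrite BE.
  rewrite -[B _]/(lift_l M X (lift_r N Y (pullback (pull_smooth_snd N M) g)) -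
    lift_r N Y (lift_l M X (pullback (pull_smooth_snd N M) g))).
  by rewrite e1 e2 e3 vf0 subrr.
Qed.

(** * Local frames *)

Section LocalFrames.
Variables (R : realType) (N : manifold R).
Local Notation n := (mfd_dim N).

Lemma vfield_sumE (I : Type) (r : seq I) (F : I -> vfield N) f :
  (\sum_(i <- r) F i) f = \sum_(i <- r) F i f.
Proof. by elim: r => [|i r IH]; rewrite ?big_nil// !big_cons vf_addE IH. Qed.

Lemma form1_sum (al : form1 N) (I : Type) (r : seq I) (F : I -> vfield N) :
  al (\sum_(i <- r) F i) = \sum_(i <- r) al (F i).
Proof.
elim: r => [|i r IH]; first by rewrite !big_nil (Cinf_linear_0 (form1P al)).
by rewrite !big_cons form1D IH.
Qed.

(* E_i = chi d/dx_i, and u_i = x_i on the support of chi. *)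
Lemma local_frame (p : N) : exists (chi : Cinf N) (u : 'I_n -> Cinf N)
    (E : 'I_n -> vfield N),
  (\forall q \near p, chi q = 1) /\
  forall Z, vfscale chi Z = \sum_i vfscale (Z (u i)) (E i).
Proof.
have [c Ac cp] := chart_cover p.
have [u uE] := chart_coord_extension Ac cp.
pose W := [set q | chart_dom c q /\ forall i, u i q = chart_map c q 0 i].
have nW : \forall q \near p, W^° q.
  by apply: open_nbhs_nbhs; split; [exact: open_interior|exact: uE].
have [r [chi [r0 rc chi0 chi1 ext]]] := chart_cutoff Ac cp nW.
set y := chart_map c p in rc chi0 chi1 ext.
have oB : open (ball y r) by exact: ball_open.
have [X1 [X1c X10]] := ext (cst 1) (fun k => Ck_cst k _ oB).
have sD i (f : Cinf N) : smooth_on (ball y r)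
    (fun x => 'D_(delta_mx 0 i) (f \o chart_inv c) x).
  move=> k; have [_ /(_ i)] := Cinf_smooth f Ac k.+1.
  by apply: Ck_sub => x /rc[].
have [Ef EfE] := choice (fun z : 'I_n * Cinf N => ext _ (sD z.1 z.2)).
have df (f : Cinf N) q i : chart_dom c q ->
    derivable (f \o chart_inv c) (chart_map c q) (delta_mx 0 i).
  move=> cq; apply: diff_derivable; have [dfc _] := Cinf_smooth f Ac 1.
  exact/dfc/chart_map_img.
have Ed i : (fun f => Ef (i, f)) \in @derivation_pred R N.
  apply/asboolP; split=> [a f g|f g]; apply: cinf_eqP => q.
    rewrite cinf_addE cinf_scaleEp.
    have [cq|ncq] := pselect (chart_dom c q); last first.
      by rewrite !(EfE (i, _)).2// mulr0 addr0.
    rewrite !(EfE (i, _)).1//=.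
    have -> : (a *: f + g : Cinf N) \o chart_inv c =
      a *: (f \o chart_inv c) + (g \o chart_inv c) by [].
    rewrite deriveD ?deriveZ; [|exact: df..|exact/derivableZ/df|exact: df].
    by rewrite /GRing.scale/=; ring.
  rewrite cinf_addE !cinf_mulE.
  have [cq|ncq] := pselect (chart_dom c q); last first.
    by rewrite !(EfE (i, _)).2// mulr0 mul0r addr0.
  rewrite !(EfE (i, _)).1//=.
  have -> : (f * g : Cinf N) \o chart_inv c =
    (f \o chart_inv c) * (g \o chart_inv c) by [].
  rewrite deriveM; [|exact: df..].
  by rewrite /GRing.scale/= !chart_mapK//; ring.
exists X1, u, (fun i => MkVfield (Ed i)); split.
  have h1 : \forall q \near p, chi (chart_map c q) = 1.
    exact: chart_map_cont Ac cp _ chi1.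
  have h2 : \forall q \near p, chart_dom c q.
    by apply: open_nbhs_nbhs; split=> //; exact: chart_dom_open.
  by apply: filterS2 h1 h2 => q q1 cq; rewrite X1c// q1 mul1r.
move=> Z; apply: vfield_eqP => f; apply: cinf_eqP => q.
rewrite vfield_sumE cinf_sumE.
change (X1 q * Z f q = \sum_i (Z (u i) * Ef (i, f)) q).
have [cq|ncq] := pselect (chart_dom c q); last first.
  rewrite X10// mul0r big1// => i _.
  by rewrite cinf_mulE (EfE (i, f)).2// mulr0.
rewrite X1c// /cst mulr1.
under eq_bigr do rewrite cinf_mulE (EfE (_, f)).1//=.
have [Bq|nBq] := pselect (ball y r (chart_map c q)); last first.
  by rewrite chi0// mul0r big1// => i _; rewrite mul0r mulr0.
have [_] := rc _ Bq; rewrite chart_mapK// => Wq.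
rewrite (ptder_coord Ac Wq f (vfield_ptder Z q)) mulr_sumr.
by apply: eq_bigr => i _; ring.
Qed.

(** Locally this turns a form, an operator on global fields, into finitely many functions al(E_i).
    The quantifier over Z stands inside the neighbourhood, so Z may vary with g. *)
Lemma form1_local (p : N) : exists (u : 'I_n -> Cinf N) (E : 'I_n -> vfield N),
  forall al : form1 N, \forall q \near p, forall Z : vfield N,
    al Z q = \sum_i Z (u i) q * al (E i) q.
Proof.
have [chi [u [E [chi1 h]]]] := local_frame p.
exists u, E => al; apply: filterS chi1 => q q1 Z.
have := congr1 (fun Y => al Y q) (h Z); rewrite form1_sum cinf_sumE form1M.
rewrite cinf_mulE q1 mul1r => ->.
by apply: eq_bigr => i _; rewrite form1M cinf_mulE.
Qed.

Lemma smooth_fun_local (f : N -> R) :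
  (forall p : N, exists F : Cinf N, \forall q \near p, f q = F q) ->
  f \in @smooth_pred R N.
Proof.
move=> h; apply/asboolP/smooth_fun_chart => p.
have [c Ac cp] := chart_cover p; have [F fF] := h p.
pose O := [set q | f q = F q]^°.
have oO : open O by exact: open_interior.
exists c, (chart_img c `&` chart_inv c @^-1` O); split=> //.
- exact: chart_inv_preim_open.
- by split; [exact: chart_map_img|rewrite /= chart_mapK].
- move=> k; apply: (Ck_eq (chart_inv_preim_open Ac oO)
    (f := F \o chart_inv c)).
    by move=> x [_ /interior_subset /= ->].
  by apply: Ck_sub (Cinf_smooth F Ac k) => x [].
Qed.

End LocalFrames.

(** * The natural action on vector fields and 1-forms *)

Section LieGroups.
Variables (R : realType) (G : lieGroup R).
Local Notation e := (lg_one G).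

Lemma lg_mulVr (g : G) : lg_mul g (lg_inv g) = e.
Proof.
rewrite -[LHS]lg_mul1 -{1}(lg_mulV (lg_inv g)) -lg_mulA.
by rewrite [lg_mul (lg_inv g) (lg_mul _ _)]lg_mulA lg_mulV lg_mul1 lg_mulV.
Qed.

Lemma lg_mulr1 (g : G) : lg_mul g e = g.
Proof. by rewrite -(lg_mulV g) lg_mulA lg_mulVr lg_mul1. Qed.

Lemma lg_inv_uniq (g k : G) : lg_mul g k = e -> k = lg_inv g.
Proof. by move=> gk; rewrite -[LHS]lg_mul1 -(lg_mulV g) -lg_mulA gk lg_mulr1. Qed.

Lemma lg_inv1 : lg_inv e = e.
Proof. by rewrite -(lg_inv_uniq (lg_mul1 e)). Qed.

Lemma lg_invK (g : G) : lg_inv (lg_inv g) = g.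
Proof. by rewrite -(lg_inv_uniq (lg_mulV g)). Qed.

Lemma lg_invM (g k : G) : lg_inv (lg_mul g k) = lg_mul (lg_inv k) (lg_inv g).
Proof.
symmetry; apply: lg_inv_uniq.
by rewrite -lg_mulA [lg_mul k _]lg_mulA lg_mulVr lg_mul1 lg_mulVr.
Qed.

Lemma lg_inv_pull : pull_smooth (@lg_inv R G).
Proof. exact/smooth_map_pull/lg_inv_smooth. Qed.

Lemma lg_mul_pull :
  pull_smooth ((fun z => lg_mul z.1 z.2) : prod_manifold G G -> G).
Proof. exact/smooth_map_pull/lg_mul_smooth. Qed.

(** Product rule along g |-> (g, g^-1) for F composed with the multiplication: F(g g^-1) is
    constant. *)
Lemma ptder_inv dl (F F' : Cinf G) : ptder e dl ->
  (forall g, F' g = F (lg_inv g)) -> dl F' = - dl F.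
Proof.
move=> D FE.
have := ptder_diag (pull_smooth_id G) lg_inv_pull
  (Psi := pullback lg_mul_pull F) (F := cinf_cst G (F e)) (F1 := F) (F2 := F') D.
rewrite (ptder_cst _ D) => h; apply/eqP; rewrite -addr_eq0 addrC eq_sym.
apply/eqP; apply: h => z /=.
- by rewrite lg_mulVr.
- by rewrite lg_inv1 lg_mulr1.
- by rewrite lg_mul1 FE.
Qed.

End LieGroups.

(** * Push-forward by the action *)

Section GroupAction.
Variables (R : realType) (G : lieGroup R) (M : manifold R).
Variable act : G -> M -> M.
Hypothesis act_smooth : smooth_action act.
Local Notation e := (lg_one G).
Local Notation GM := (prod_manifold G M).

Lemma act1 p : act e p = p. Proof. by case: act_smooth. Qed.

Lemma actM g k p : act (lg_mul g k) p = act g (act k p).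
Proof. by case: act_smooth. Qed.

Lemma actVK g p : act (lg_inv g) (act g p) = p.
Proof. by rewrite -actM lg_mulV act1. Qed.

Lemma actKV g p : act g (act (lg_inv g) p) = p.
Proof. by rewrite -actM lg_mulVr act1. Qed.

Lemma act_pull2 : pull_smooth ((fun z => act z.1 z.2) : GM -> M).
Proof. by apply: smooth_map_pull; case: act_smooth. Qed.

Lemma act_pull g : pull_smooth (act g).
Proof.
exact: pull_smooth_comp
  (pull_smooth_pair (pull_smooth_cst M g) (pull_smooth_id M)) act_pull2.
Qed.

Lemma inv_fst_pull : pull_smooth ((fun z => (lg_inv z.1, z.2)) : GM -> GM).
Proof.
apply: pull_smooth_pair; last exact: pull_smooth_snd.
exact: pull_smooth_comp (@pull_smooth_fst _ G M) (lg_inv_pull G).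
Qed.

Lemma actV_pull2 : pull_smooth ((fun z => act (lg_inv z.1) z.2) : GM -> M).
Proof. exact: pull_smooth_comp inv_fst_pull act_pull2. Qed.

Lemma orbit_pull p : pull_smooth (fun g => act (lg_inv g) p).
Proof.
exact: pull_smooth_comp
  (pull_smooth_pair (pull_smooth_id G) (pull_smooth_cst G p)) actV_pull2.
Qed.

Lemma shear_pull :
  pull_smooth ((fun z => (z.1, act (lg_inv z.1) z.2)) : GM -> GM).
Proof.
by apply: pull_smooth_pair; [exact: pull_smooth_fst|exact: actV_pull2].
Qed.

Definition cact g : Cinf M -> Cinf M := pullback (act_pull g).

Lemma cactE g f p : cact g f p = f (act g p). Proof. by []. Qed.

Lemma cact1 f : cact e f = f.
Proof. by apply: cinf_eqP => p; rewrite cactE act1. Qed.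

Lemma cactM g k f : cact (lg_mul g k) f = cact k (cact g f).
Proof. by apply: cinf_eqP => p; rewrite !cactE actM. Qed.

Lemma cactVK g f : cact (lg_inv g) (cact g f) = f.
Proof. by apply: cinf_eqP => p; rewrite !cactE actKV. Qed.

Lemma cact_mul g f f' : cact g (f * f') = cact g f * cact g f'.
Proof. exact: cinf_eqP. Qed.

Lemma cact_lin g (a : R) f f' : cact g (a *: f + f') = a *: cact g f + cact g f'.
Proof. exact: cinf_eqP. Qed.

Lemma cactD g f f' : cact g (f + f') = cact g f + cact g f'.
Proof. exact: cinf_eqP. Qed.

Lemma pushv_subproof g (X : vfield M) :
  (fun f => cact (lg_inv g) (X (cact g f))) \in @derivation_pred R M.
Proof.
apply/asboolP; split=> [a f f'|f f']; first by rewrite cact_lin vf_linear cact_lin.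
by rewrite cact_mul vfM cactD !cact_mul !cactVK.
Qed.
Definition pushv g X : vfield M := MkVfield (pushv_subproof g X).

Lemma pushvE g X f : pushv g X f = cact (lg_inv g) (X (cact g f)).
Proof. by []. Qed.

Lemma pushv1 X : pushv e X = X.
Proof. by apply: vfield_eqP => f; rewrite pushvE lg_inv1 !cact1. Qed.

Lemma pushvM g k X : pushv (lg_mul g k) X = pushv g (pushv k X).
Proof. by apply: vfield_eqP => f; rewrite !pushvE lg_invM !cactM. Qed.

Lemma pushvD g X Y : pushv g (X + Y) = pushv g X + pushv g Y.
Proof. by apply: vfield_eqP => f; rewrite vf_addE !pushvE vf_addE cactD. Qed.

Lemma pushv_scale g f X :
  pushv g (vfscale f X) = vfscale (cact (lg_inv g) f) (pushv g X).
Proof. by apply: vfield_eqP => h; rewrite /= cact_mul. Qed.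

Lemma pushf_subproof g (al : form1 M) :
  (fun Y => cact (lg_inv g) (al (pushv (lg_inv g) Y))) \in @form1_pred R M.
Proof.
apply/asboolP/Cinf_linearP => [X Y|f X].
  by rewrite pushvD form1D cactD.
by rewrite pushv_scale form1M cact_mul lg_invK cactVK.
Qed.
Definition pushf g al : form1 M := MkForm1 (pushf_subproof g al).

Lemma pushfE g al Y :
  pushf g al Y = cact (lg_inv g) (al (pushv (lg_inv g) Y)).
Proof. by []. Qed.

Lemma form1_eqP (al be : form1 M) : (forall X, al X = be X) -> al = be.
Proof. by move=> h; apply/val_inj/funext. Qed.

Lemma pushf1 al : pushf e al = al.
Proof. by apply: form1_eqP => Y; rewrite pushfE lg_inv1 cact1 pushv1. Qed.

Lemma pushfM g k al : pushf (lg_mul g k) al = pushf g (pushf k al).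
Proof.
by apply: form1_eqP => Y; rewrite !pushfE lg_invM cactM pushvM.
Qed.

Lemma pushfD g al be : pushf g (al + be) = pushf g al + pushf g be.
Proof. by apply: form1_eqP => Y; exact: cactD. Qed.

Lemma pushf_scale g f al :
  pushf g (f1scale f al) = f1scale (cact (lg_inv g) f) (pushf g al).
Proof. by apply: form1_eqP => Y; exact: cact_mul. Qed.

Definition gpush g (s : gsection M) : gsection M := (pushv g s.1, pushf g s.2).

Definition lift_action f : Cinf GM := pullback act_pull2 f.

Lemma slice_lift_action g f : slice_r g (lift_action f) = cact g f.
Proof. exact: cinf_eqP. Qed.

(* The push-forward at (g, p) is this function at (g, g^-1 p). *)
Definition unsheared_pushv X f : Cinf GM := lift_r G X (lift_action f).

Lemma unsheared_pushvE X f z : unsheared_pushv X f z = X (cact z.1 f) z.2.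
Proof. by rewrite /unsheared_pushv lift_rE slice_lift_action. Qed.

Definition joint_pushv X f : Cinf GM := pullback shear_pull (unsheared_pushv X f).

Lemma joint_pushvE X f z : joint_pushv X f z = pushv z.1 X f z.2.
Proof. by rewrite -[LHS]/(unsheared_pushv X f _) unsheared_pushvE. Qed.

(** In a local frame the function is a sum of al(E_i) times the push-forward of Y applied to u_i,
    which is already jointly smooth by [joint_pushv]. *)
Lemma unsheared_pushf_smooth (al : form1 M) (Y : vfield M) :
  (fun z : GM => al (pushv (lg_inv z.1) Y) z.2) \in @smooth_pred R GM.
Proof.
apply: smooth_fun_local => -[g0 p0].
have [u [E h]] := form1_local p0.
exists (\sum_i pullback inv_fst_pull (joint_pushv Y (u i)) *
              pullback (pull_smooth_snd G M) (al (E i))).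
have h2 : \forall z \near ((g0, p0) : GM), forall Z : vfield M,
    al Z z.2 = \sum_i Z (u i) z.2 * al (E i) z.2.
  by have := @pull_smooth_snd _ G M; case=> c _; exact: (c (g0, p0) _ (h al)).
apply: filterS h2 => z ->; rewrite cinf_sumE; apply: eq_bigr => i _.
by rewrite cinf_mulE -[pullback inv_fst_pull _ z]/(joint_pushv _ _ _) joint_pushvE.
Qed.

Definition unsheared_pushf al Y : Cinf GM := MkCinf (unsheared_pushf_smooth al Y).

Definition joint_pushf al Y : Cinf GM := pullback shear_pull (unsheared_pushf al Y).

Lemma joint_pushfE al Y z : joint_pushf al Y z = pushf z.1 al Y z.2.
Proof. by []. Qed.

Lemma gpush_bundle_action : is_bundle_action act gpush.
Proof.
split.
- by move=> [X al]; rewrite /gpush pushv1 pushf1.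
- by move=> g k [X al]; rewrite /gpush pushvM pushfM.
- by move=> g [X al] [Y be]; rewrite /gpush /= pushvD pushfD.
- move=> g f f' [X al] ff'; rewrite /gpush /gscale /= pushv_scale pushf_scale.
  suff -> : cact (lg_inv g) f = f' by [].
  by apply: cinf_eqP => p; rewrite cactE -ff' actKV.
- move=> [X al]; split=> [f|Y].
    have -> : (fun x : G * M => (gpush x.1 (X, al)).1 f x.2) = joint_pushv X f.
      by apply/funext => z; rewrite joint_pushvE.
    by have /asboolP := cinf_valP (joint_pushv X f).
  have -> : (fun x : G * M => (gpush x.1 (X, al)).2 Y x.2) = joint_pushf al Y.
    by apply/funext => z; rewrite joint_pushfE.
  by have /asboolP := cinf_valP (joint_pushf al Y).
Qed.

Lemma pushv0 g : pushv g 0 = 0.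
Proof. by apply: (@addrI _ (pushv g 0)); rewrite -pushvD !addr0. Qed.

Lemma pushf0 g : pushf g 0 = 0.
Proof. by apply: (@addrI _ (pushf g 0)); rewrite -pushfD !addr0. Qed.

Lemma gpush_splitting : preserves_splitting gpush.
Proof.
by split=> g x; rewrite /gpush /= ?pushf0 ?pushv0.
Qed.

(** * Derivatives of the push-forwards at the identity *)

Variable psi : lieG G -> vfield M.
Hypothesis psiP : is_infinitesimal_action act psi.

Definition orbit_fun f p : Cinf G := pullback (orbit_pull p) f.

Lemma lie_ptder (xi : lieG G) : ptder e (fun F => lie_val xi F e).
Proof. exact: vfield_ptder. Qed.

Lemma psiE xi f p : psi xi f p = lie_val xi (orbit_fun f p) e.
Proof.
have [F FE <-] := psiP xi f p; congr (lie_val xi _ e).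
exact: cinf_eqP.
Qed.

(* Product rule along the curve g |-> (g, g^-1 p) through (1, p). *)
Lemma orbit_derivative (xi : lieG G) (Psi : Cinf GM) (F F1 : Cinf G) (f : Cinf M) p :
  (forall g, F g = Psi (g, act (lg_inv g) p)) ->
  (forall g, F1 g = Psi (g, p)) -> (forall q, f q = Psi (e, q)) ->
  lie_val xi F e = lie_val xi F1 e + psi xi f p.
Proof.
move=> FE F1E fE; rewrite psiE.
apply: (ptder_diag (pull_smooth_id G) (orbit_pull p) (lie_ptder xi) (Psi := Psi)).
- exact: FE.
- by move=> g; rewrite F1E lg_inv1 act1.
- by move=> g; rewrite -fE.
Qed.

Definition pushv_curve X f p : Cinf G := slice_l p (joint_pushv X f).

Lemma pushv_curveE X f p g : pushv_curve X f p g = pushv g X f p.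
Proof. by rewrite -[LHS]/(joint_pushv X f (g, p)) joint_pushvE. Qed.

(** [psi] differentiates f(g^-1 q), this is the derivative of f(g q); inversion supplies the sign
    that makes a commutator out of the product rule. *)
Lemma lie_lift_action xi f :
  slice_r e (lift_l M (lie_val xi) (lift_action f)) = - psi xi f.
Proof.
apply: cinf_eqP => q; rewrite slice_rE lift_lE cinf_oppE psiE /=.
rewrite (@ptder_inv _ _ _ (slice_l q (lift_action f)) (orbit_fun f q)
  (lie_ptder xi)) ?opprK//.
Qed.

(** The push-forward is X(f o g) at g^-1 p. The moving base point contributes psi(X f); for the
    moving function the derivation in g passes through X by [lift_comm] and leaves - X(psi f). *)
Lemma pushv_derivative xi X f p :
  lie_val xi (pushv_curve X f p) e = vfbracket (psi xi) X f p.
Proof.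
rewrite (@orbit_derivative xi (unsheared_pushv X f) _
  (slice_l p (unsheared_pushv X f)) (X f) p).
- have -> : lie_val xi (slice_l p (unsheared_pushv X f)) e =
      lift_l M (lie_val xi) (lift_r G X (lift_action f)) (e, p).
    by rewrite lift_lE.
  rewrite lift_comm lift_rE lie_lift_action vfN cinf_oppE addrC.
  by [].
- by move=> g; rewrite pushv_curveE unsheared_pushvE.
- by move=> g.
- by move=> q; rewrite unsheared_pushvE cact1.
Qed.

Definition pushf_curve al Y p : Cinf G := slice_l p (joint_pushf al Y).

(** The moving base point contributes psi(al Y). At a fixed base point a frame reduces the rest to
    the curves of the push-forward of Y by g^-1 on the u_i, with derivative - [psi, Y](u_i); these
    reassemble to - al([psi, Y]). *)
Lemma pushf_derivative xi al Y p :
  lie_val xi (pushf_curve al Y p) e = lie1 (psi xi) al Y p.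
Proof.
rewrite (@orbit_derivative xi (unsheared_pushf al Y) _
  (slice_l p (unsheared_pushf al Y)) (al Y) p).
- have [u [E /(_ al) /nbhs_singleton h]] := form1_local p.
  pose K i : Cinf G := pullback (lg_inv_pull G) (pushv_curve Y (u i) p).
  have -> : slice_l p (unsheared_pushf al Y) = \sum_i al (E i) p *: K i.
    apply: cinf_eqP => g; rewrite cinf_sumE.
    rewrite -[LHS]/(al (pushv (lg_inv g) Y) p) h; apply: eq_bigr => i _.
    by rewrite cinf_scaleEp -[K i g]/(pushv_curve _ _ _ _) pushv_curveE mulrC.
  rewrite (ptder_sum _ _ (lie_ptder xi)) -[lie1 _ _ _ _]/(psi xi (al Y) p -
    al (vfbracket (psi xi) Y) p) addrC; congr (_ + _).
  rewrite h -sumrN; apply: eq_bigr => i _.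
  rewrite (ptderZ _ _ (lie_ptder xi)).
  rewrite (@ptder_inv _ _ _ (pushv_curve Y (u i) p) (K i) (lie_ptder xi))//.
  by rewrite pushv_derivative mulrN mulrC.
- by move=> g.
- by move=> g.
- move=> q; rewrite -[RHS]/(al (pushv (lg_inv e) Y) q) lg_inv1 pushv1.
  by [].
Qed.

Lemma psi_linear : linear psi.
Proof.
move=> a xi eta; apply: vfield_eqP => f; apply: cinf_eqP => p.
rewrite vf_addE cinf_addE.
rewrite -[(a *: psi xi) f p]/(a * psi xi f p) !psiE.
by [].
Qed.

Lemma psi_bracket xi eta : psi (lb_br xi eta) = vfbracket (psi xi) (psi eta).
Proof.
apply: vfield_eqP => f; apply: cinf_eqP => p.
(* The left-invariant field of zeta and [psi zeta] are related by g |-> g^-1 p: as (g k)^-1 p = k^-1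
   (g^-1 p), left translation of an orbit function only moves its base point. *)
have H (zeta : lieG G) : lie_val zeta (orbit_fun f p) = orbit_fun (psi zeta f) p.
  apply: cinf_eqP => g; rewrite -[RHS]/(psi zeta f (act (lg_inv g) p)) psiE.
  have /asboolP L := lie_valP zeta; rewrite -{1}(lg_mulr1 g).
  rewrite -(L g (orbit_fun f p) (orbit_fun f (act (lg_inv g) p)))//.
  move=> k; rewrite -[LHS]/(f _) -[RHS]/(f _); congr (f _).
  by rewrite lg_invM actM.
rewrite psiE -[lie_val _ _ e]/(lie_val xi (lie_val eta (orbit_fun f p)) e -
  lie_val eta (lie_val xi (orbit_fun f p)) e) !H -!psiE.
by [].
Qed.

End GroupAction.

(** * Extended actions *)

Section TwistedBracket.
Variables (R : realType) (M : manifold R) (b : form2 M).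
Implicit Types (X Y Z : vfield M) (f : Cinf M).

(** The term d f drops out since d d = 0, and the twist i_X d b completes d i_X b to L_X b. *)
Lemma dorfman_exact X f Y (be : form1 M) :
  dorfman (d2 b) (X, d0 f + i2 X b) (Y, be) =
  (vfbracket X Y, lie1 X be - i2 Y (lie2 X b)).
Proof.
congr (_, _); apply: form1_eqP => Z.
rewrite -[LHS]/(X (be Z) - be (vfbracket X Z) -
  (Y (Z f + b X Z) - Z (Y f + b X Y) -
   (vfbracket Y Z f + b X (vfbracket Y Z))) -
  (X (b Y Z) - Y (b X Z) + Z (b X Y) - b (vfbracket X Y) Z +
   b (vfbracket X Z) Y - b (vfbracket Y Z) X)).
rewrite -[RHS]/(X (be Z) - be (vfbracket X Z) -
  (X (b Y Z) - b (vfbracket X Y) Z - b Y (vfbracket X Z))).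
rewrite (form2C b Y (vfbracket X Z)) (form2C b X (vfbracket Y Z)) !vfD.
by rewrite -[vfbracket Y Z f]/(Y (Z f) - Z (Y f)); ring.
Qed.

(** L_X commutes with d, and L_X i_Y - i_Y L_X = i_[X,Y]. So the term - i_Y L_X b of the bracket is
    exactly what closes the sections d f + i_Y b under it, invariant b or not. *)
Lemma lie1_exact X Y f :
  lie1 X (d0 f + i2 Y b) - i2 Y (lie2 X b) =
  d0 (X f) + i2 (vfbracket X Y) b.
Proof.
apply: form1_eqP => Z.
rewrite -[LHS]/(X (Z f + b Y Z) - (vfbracket X Z f + b Y (vfbracket X Z)) -
  (X (b Y Z) - b (vfbracket X Y) Z - b Y (vfbracket X Z))).
rewrite -[RHS]/(Z (X f) + b (vfbracket X Y) Z) vfD.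
by rewrite -[vfbracket X Z f]/(X (Z f) - Z (X f)); ring.
Qed.

End TwistedBracket.

Lemma linear_fun0 (R : realType) (U V : lmodType R) (f : U -> V) :
  linear f -> f 0 = 0.
Proof.
move=> lf; apply: (@addrI _ (f 0)).
by rewrite -[X in X + _]scale1r -lf scale1r !addr0.
Qed.

Lemma form2_eq0 (R : realType) (M : manifold R) (w : form2 M) :
  (forall X Y p, w X Y p = 0) -> w = 0.
Proof.
move=> w0; apply/val_inj/funext => X; apply/funext => Y.
by apply: cinf_eqP => p; rewrite -[LHS]/(w X Y p) w0.
Qed.

Theorem proposition3p2 (R : realType) (G : lieGroup R)
    (Gcompact : compact [set: G]) (M : manifold R)
    (act : G -> M -> M) (act_smooth : smooth_action act)
    (psi : lieG G -> vfield M) (psiP : is_infinitesimal_action act psi)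
    (h : lieModule (lieG G)) (mu : {linear h -> Cinf M})
    (mu_equivariant : forall (xi : lieG G) (eta : h),
       mu (lm_act xi eta) = psi xi (mu eta))
    (b : form2 M) :
  is_extended_action act psi (d2 b)
    (fun u : hemisemidirect h => (psi u.1, d0 (mu u.2) + i2 (psi u.1) b))
  <-> forall xi : lieG G, lie2 (psi xi) b = 0.
Proof.
split=> [[_ _ _ [T [_ [T0 _] Tint]]] xi|inv].
- apply: form2_eq0 => Y Z p.
  (* Taking eta = 0 loses nothing, as d mu(eta) does not enter the bracket. The witness F is known
     only through its values on G, which the splitting makes 0. *)
  have [_ /(_ Z) [F F0]] := Tint (xi, 0) (Y, 0) p.
  rewrite dorfman_exact.
  have -> : F = 0 by apply: cinf_eqP => g; rewrite F0 T0.
  rewrite vf0.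
  rewrite -[X in _ = X]/(psi xi 0 p - 0 - lie2 (psi xi) b Y Z p) vf0.
  by rewrite subrr sub0r => /esym/eqP; rewrite oppr_eq0 => /eqP.
- have D u X be : dorfman (d2 b) (psi u.1, d0 (mu u.2) + i2 (psi u.1) b) (X, be) =
      (vfbracket (psi u.1) X, lie1 (psi u.1) be).
    by rewrite dorfman_exact inv; congr (_, _); apply: form1_eqP => Z; exact: subr0.
  have psi_lin := psi_linear act_smooth psiP.
  have psi0 : psi 0 = 0 by exact: linear_fun0.
  split.
  + split; first by move=> x; exists (x, 0).
    move=> u v u0 v0; rewrite -[LHS]/(lb_br u.1 v.1, lm_act u.1 v.2).
    have {u0} -> : u.1 = 0 by exact: u0.
    by rewrite (linear_fun0 (lb_linearl v.1)) (linear_fun0 (lm_linearl v.2)).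
  + split.
    * move=> a u v; rewrite psi_lin linearP; congr (_, _).
      apply: form1_eqP => Z.
      rewrite -[LHS]/(Z (a *: mu u.2 + mu v.2) + b (a *: psi u.1 + psi v.1) Z).
      rewrite -[RHS]/(a *: (Z (mu u.2) + b (psi u.1) Z) + (Z (mu v.2) + b (psi v.1) Z)).
      rewrite vf_linear form2Dl.
      have -> : b (a *: psi u.1) Z = a *: b (psi u.1) Z.
        have -> : a *: psi u.1 = vfscale (cinf_cst M a) (psi u.1).
          by apply: vfield_eqP => f; exact: cinf_scaleE.
        by rewrite form2Ml -cinf_scaleE.
      by rewrite scalerDr addrACA.
    (* Equivariance turns mu(xi . eta) into the function X f of [lie1_exact]; the term - i_Y L_X b
       that this identity brings in is 0 by [inv]. *)
    * move=> u v; rewrite D /= (psi_bracket act_smooth psiP) mu_equivariant; congr (_, _).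
      by rewrite -lie1_exact inv; apply: form1_eqP => Z; exact: subr0.
    * by [].
  + move=> u u0 [X be]; rewrite D.
    have {u0} -> : u.1 = 0 by exact: u0.
    rewrite psi0 (linear_fun0 (vfbracket_linearl X)); congr (_, _).
    apply: form1_eqP => Z; rewrite -[LHS]/(0 - be (vfbracket 0 Z)).
    by rewrite (linear_fun0 (vfbracket_linearl Z)) (Cinf_linear_0 (form1P be)) subr0.
  + exists (gpush act_smooth); split.
    * exact: gpush_bundle_action.
    * exact: gpush_splitting.
    * move=> u [X be] p; rewrite D /=; split=> [f|Y].
        exists (pushv_curve act_smooth X f p).
          by move=> g; rewrite pushv_curveE.
        exact: pushv_derivative.
      exists (pushf_curve act_smooth be Y p) => //.
      exact: pushf_derivative.
Qed.
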